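(* Let $f$ be a locally univalent analytic function in the unit disk $\mathbb{D}$ with $f''(0)=0$. (i) If $|Sf(z)|\le 2a^2$ for all $z\in\mathbb{D}$, where $a=0.653\ldots$ is the first positive solution of $2a\tan(a)=1$, then $f$ is a convex mapping. (ii) If for some $n\in\mathbb{N}$ (a positive integer) one has $|Sf(z)|\le n|z|^{n-1}-\frac12|z|^{2n}$ for all $z\in\mathbb{D}$, then $f$ is a convex mapping.
   Context: $\mathbb{D}=\{z\in\mathbb{C}:|z|<1\}$. A function $f$ analytic in $\mathbb{D}$ is locally univalent if $f'(z)\ne0$ for all $z\in\mathbb{D}$. The Schwarzian derivative is $Sf=\left(\frac{f''}{f'}\right)'-\frac12\left(\frac{f''}{f'}\right)^2$. A convex mapping is a univalent analytic function in $\mathbb{D}$ with convex image; equivalently, $f$ is locally univalent and $\operatorname{Re}\{1+zf''(z)/f'(z)\}>0$ for all $z\in\mathbb{D}$. *)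

(* Defs.v *)
From Stdlib Require Import Reals.
From Coquelicot Require Import Coquelicot.

Open Scope R_scope.

(* Functions on the disk are total functions C -> C of which only the values on
   the open set [disk] matter: [C_derive f z] depends only on the germ of [f]
   at [z], and is the complex derivative wherever [f] is complex
   differentiable. *)

Definition disk (z : C) : Prop := Cmod z < 1.

Definition analytic_in_disk (f : C -> C) : Prop :=
  forall z : C, disk z ->
    exists (c : nat -> C) (r : R), 0 < r /\
      forall w : C, Cmod (w - z) < r ->
        is_pseries (K := C_AbsRing) (V := C_NormedModule) c (w - z)%C (f w).

Definition locally_univalent (f : C -> C) : Prop :=
  forall z : C, disk z -> C_derive f z <> RtoC 0.

Definition pre_schwarzian (f : C -> C) (z : C) : C :=
  (C_derive (C_derive f) z / C_derive f z)%C.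

Definition schwarzian (f : C -> C) (z : C) : C :=
  (C_derive (pre_schwarzian f) z - / 2 * pre_schwarzian f z ^ 2)%C.

Definition univalent (f : C -> C) : Prop :=
  forall z w : C, disk z -> disk w -> f z = f w -> z = w.

Definition disk_image (f : C -> C) (p : C) : Prop :=
  exists z : C, disk z /\ f z = p.

Definition convex_set (A : C -> Prop) : Prop :=
  forall (p q : C) (t : R), A p -> A q -> 0 <= t <= 1 ->
    A (RtoC (1 - t) * p + RtoC t * q)%C.

Definition convex_mapping (f : C -> C) : Prop :=
  analytic_in_disk f /\ univalent f /\ convex_set (disk_image f).

(* Stdlib's [tan] is total, with junk values at the zeros of [cos]; hence the
   requirement that [cos x] be nonzero. *)
Definition is_solution (x : R) : Prop := cos x <> 0 /\ 2 * x * tan x = 1.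

Definition first_positive_solution (a : R) : Prop :=
  0 < a /\ is_solution a /\ forall b : R, 0 < b -> is_solution b -> a <= b.

(* Main.v *)
Require Import Defs.
From Stdlib Require Import Reals Lra Lia Psatz ClassicalEpsilon.
From Coquelicot Require Import Coquelicot.

(** Put [p = f''/f'], so that [Sf = p' - p^2/2] and [p(0) = 0].

    Both hypotheses give [|p(z)| <= |z|].  Along a radius [p' = Sf + p^2/2], so
    [|p|] is dominated by any nonnegative [y] with [|Sf| <= y' - y^2/2]
    ([pre_schwarzian_le_majorant]).  In (i) take [y = 2 a tan (a x)], for which
    [y' - y^2/2 = 2 a^2]; since [tan] is convex and [2 a tan a = 1], this [y]
    lies below the chord [x].  In (ii) take [y = x^n].

    The bound [|p(z)| <= |z|] is stronger than the classical criterion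
    [Re (1 + z f''/f') > 0] and gives convexity by an elementary argument.
    - Univalence: [f'' = p f'] integrates to
      [|f'(z)/f'(0) - 1| <= exp (|z|^2/2) - 1 <= 3/4], so [f] is a perturbation
      of the linear map [f'(0) z] with Lipschitz constant [3/4 |f'(0)|]
      ([near_linear]).  Hence [f] is injective with Lipschitz inverse, and its
      image contains discs of a uniform radius around the values taken on
      [|z| <= r < 1].
    - Convexity: let [g] be the preimage of a segment, with [f o g] affine.  Then
      [g'' = - p(g) g'^2], so the second derivative of [|g|^2] is
      [2 |g'|^2 - 2 Re (conj g p(g) g'^2) >= 2 |g'|^2 (1 - |g p(g)|) >= 0], and
      [|g|] is at most its value at the worse end point
      ([lifted_segment_bound]).  So a segment in the image stays over
      [|z| <= max (|z0|, |z1|)]; by uniform openness its end point can be moved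
      by a fixed amount, and finitely many such moves take the trivial segment
      at [f(z0)] to the segment from [f(z0)] to [f(z1)].

    The critical value [a] is the zero of [2 x sin x - cos x], which increases
    on [(0, 1]]. *)

Open Scope R_scope.

(** * Derivatives of complex functions and of paths *)

(** The modulus version of [is_derive]: the ring [C] and the normed module [C]
    carry different uniform structures, and a bound on [Cmod] refers to neither. *)
Definition cderiv (f : C -> C) (z l : C) : Prop :=
  forall eps : R, 0 < eps -> exists delta : R, 0 < delta /\
    forall w : C, Cmod (w - z) < delta ->
      Cmod (f w - f z - l * (w - z)) <= eps * Cmod (w - z).

Definition pderiv (q : R -> C) (t : R) (l : C) : Prop :=
  forall eps : R, 0 < eps -> exists delta : R, 0 < delta /\
    forall s : R, Rabs (s - t) < delta ->
      Cmod (q s - q t - l * RtoC (s - t)) <= eps * Rabs (s - t).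

Lemma Cmod_sym (z w : C) : Cmod (z - w) = Cmod (w - z).
Proof. rewrite <- Cmod_opp. f_equal. ring. Qed.

Lemma Cmod_triangle_minus (z w : C) : Cmod (z - w) <= Cmod z + Cmod w.
Proof. rewrite <- (Cmod_opp w). apply Cmod_triangle. Qed.

Lemma Cmod_triangle_inv (z w : C) : Cmod z - Cmod w <= Cmod (z - w).
Proof.
  pose proof (Cmod_triangle (z - w) w) as H.
  replace (z - w + w)%C with z in H by ring. lra.
Qed.

Lemma Cminus_eq_0 (z w : C) : (z - w)%C = 0 -> z = w.
Proof. intros H. replace z with (z - w + w)%C by ring. rewrite H. ring. Qed.

Lemma cderiv_C_derive (f : C -> C) (z l : C) : cderiv f z l -> C_derive f z = l.
Proof.
  intros H. apply is_C_derive_unique. split.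
  - apply is_linear_scal_l.
  - intros x Hx eps.
    apply (@is_filter_lim_locally_unique C_AbsRing (AbsRing_NormedModule C_AbsRing)) in Hx.
    subst x.
    destruct (H eps (cond_pos eps)) as [d [Hd Hw]].
    exists (mkposreal d Hd). intros w Bw.
    specialize (Hw w Bw).
    change (Cmod (f w - f z - (w - z) * l) <= eps * Cmod (w - z)).
    replace ((w - z) * l)%C with (l * (w - z))%C by ring. exact Hw.
Qed.

Lemma cderiv_bound (f : C -> C) (z l : C) :
  cderiv f z l -> exists delta : R, 0 < delta /\
    forall w : C, Cmod (w - z) < delta ->
      Cmod (f w - f z) <= (Cmod l + 1) * Cmod (w - z).
Proof.
  intros H. destruct (H 1 Rlt_0_1) as [d [Hd Hw]].
  exists d. split; [exact Hd|]. intros w Hz. specialize (Hw w Hz).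
  replace (f w - f z)%C with ((f w - f z - l * (w - z)) + l * (w - z))%C by ring.
  eapply Rle_trans; [apply Cmod_triangle|]. rewrite Cmod_mult. lra.
Qed.

Lemma cderiv_continuous (f : C -> C) (z l : C) :
  cderiv f z l -> forall eps : R, 0 < eps -> exists delta : R, 0 < delta /\
    forall w : C, Cmod (w - z) < delta -> Cmod (f w - f z) <= eps.
Proof.
  intros H eps Heps. destruct (cderiv_bound f z l H) as [d [Hd Hw]].
  pose proof (Cmod_ge_0 l) as Hl.
  exists (Rmin d (eps / (Cmod l + 1))). split.
  - apply Rmin_pos; [exact Hd | apply Rdiv_lt_0_compat; lra].
  - intros w Hz.
    assert (Cmod (w - z) < eps / (Cmod l + 1)) as H1
      by (eapply Rlt_le_trans; [exact Hz | apply Rmin_r]).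
    eapply Rle_trans.
    + apply Hw. eapply Rlt_le_trans; [exact Hz | apply Rmin_l].
    + apply Rlt_le. apply Rmult_lt_compat_l with (r := Cmod l + 1) in H1; [|lra].
      replace ((Cmod l + 1) * (eps / (Cmod l + 1))) with eps in H1 by (field; lra).
      exact H1.
Qed.

Lemma cderiv_const (a z : C) : cderiv (fun _ => a) z 0.
Proof.
  intros eps Heps. exists 1. split; [lra|]. intros w _.
  replace (a - a - 0 * (w - z))%C with (RtoC 0) by ring. rewrite Cmod_0.
  apply Rmult_le_pos; [lra | apply Cmod_ge_0].
Qed.

Lemma cderiv_affine (f : C -> C) (z l a b : C) :
  cderiv f z l -> cderiv (fun w => a * w + b * f w)%C z (a + b * l)%C.
Proof.
  intros H eps Heps. pose proof (Cmod_ge_0 b) as Hb.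
  destruct (H (eps / (Cmod b + 1))) as [d [Hd Hw]].
  { apply Rdiv_lt_0_compat; lra. }
  exists d. split; [exact Hd|]. intros w Hz. specialize (Hw w Hz).
  replace (a * w + b * f w - (a * z + b * f z) - (a + b * l) * (w - z))%C
    with (b * (f w - f z - l * (w - z)))%C by ring.
  rewrite Cmod_mult.
  apply Rle_trans with (Cmod b * (eps / (Cmod b + 1) * Cmod (w - z))).
  - now apply Rmult_le_compat_l.
  - rewrite <- Rmult_assoc. apply Rmult_le_compat_r; [apply Cmod_ge_0|].
    replace (Cmod b * (eps / (Cmod b + 1)))
      with (eps - eps / (Cmod b + 1)) by (field; lra).
    assert (0 < eps / (Cmod b + 1)) by (apply Rdiv_lt_0_compat; lra). lra.
Qed.

(** With [e_F], [e_G] the first-order errors of [F], [G] at [z] and [N] the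
    claimed derivative, the error of the quotient is exactly
    [(e_F - F(z)/G(z) e_G - N (w - z) (G(w) - G(z))) / G(w)]. *)
Lemma cderiv_div (F G : C -> C) (z F' G' : C) :
  G z <> 0 -> cderiv F z F' -> cderiv G z G' ->
  cderiv (fun w => F w / G w)%C z ((F' * G z - F z * G') / (G z * G z))%C.
Proof.
  intros Hz HF HG eps Heps.
  set (N := ((F' * G z - F z * G') / (G z * G z))%C).
  assert (0 < Cmod (G z)) as Gpos by now apply Cmod_gt_0.
  pose proof (Cmod_ge_0 (F z / G z)) as P1.
  pose proof (Cmod_ge_0 N) as P2.
  set (T := 1 + Cmod (F z / G z) + Cmod N).
  set (e := eps * (Cmod (G z) / 2) / T).
  assert (0 < T) as HT by (unfold T; lra).
  assert (0 < e) as He.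
  { apply Rdiv_lt_0_compat; [apply Rmult_lt_0_compat; lra | exact HT]. }
  destruct (HF e He) as [d1 [Hd1 H1]].
  destruct (HG e He) as [d2 [Hd2 H2]].
  destruct (cderiv_continuous G z G' HG e He) as [d3 [Hd3 H3]].
  destruct (cderiv_continuous G z G' HG (Cmod (G z) / 2)) as [d4 [Hd4 H4]]; [lra|].
  exists (Rmin (Rmin d1 d2) (Rmin d3 d4)). split.
  { repeat apply Rmin_pos; assumption. }
  intros w Hw.
  assert (Cmod (w - z) < d1 /\ Cmod (w - z) < d2 /\ Cmod (w - z) < d3
          /\ Cmod (w - z) < d4) as (W1 & W2 & W3 & W4).
  { pose proof (Rmin_l (Rmin d1 d2) (Rmin d3 d4)).
    pose proof (Rmin_r (Rmin d1 d2) (Rmin d3 d4)).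
    pose proof (Rmin_l d1 d2). pose proof (Rmin_r d1 d2).
    pose proof (Rmin_l d3 d4). pose proof (Rmin_r d3 d4). lra. }
  specialize (H1 w W1). specialize (H2 w W2).
  specialize (H3 w W3). specialize (H4 w W4).
  assert (Cmod (G z) / 2 <= Cmod (G w)) as Gw.
  { rewrite Cmod_sym in H4. pose proof (Cmod_triangle_inv (G z) (G w)). lra. }
  assert (G w <> 0) as Gw0 by (apply Cmod_gt_0; lra).
  replace (F w / G w - F z / G z - N * (w - z))%C
    with (((F w - F z - F' * (w - z)) - F z / G z * (G w - G z - G' * (w - z))
           - N * (w - z) * (G w - G z)) / G w)%C
    by (unfold N; field; auto).
  rewrite Cmod_div by exact Gw0.
  pose proof (Cmod_ge_0 (w - z)) as P0.
  assert (Cmod (F w - F z - F' * (w - z) - F z / G z * (G w - G z - G' * (w - z))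
           - N * (w - z) * (G w - G z)) <= T * e * Cmod (w - z)) as B.
  { eapply Rle_trans; [apply Cmod_triangle_minus|].
    eapply Rle_trans; [apply Rplus_le_compat_r, Cmod_triangle_minus|].
    rewrite !Cmod_mult. unfold T.
    assert (Cmod (F z / G z) * Cmod (G w - G z - G' * (w - z))
            <= Cmod (F z / G z) * (e * Cmod (w - z))) by now apply Rmult_le_compat_l.
    assert (Cmod N * Cmod (w - z) * Cmod (G w - G z)
            <= Cmod N * Cmod (w - z) * e)
      by (apply Rmult_le_compat_l; [now apply Rmult_le_pos | exact H3]).
    nra. }
  replace (T * e) with (eps * (Cmod (G z) / 2)) in B by (unfold e; field; lra).
  apply Rmult_le_reg_r with (Cmod (G w)); [lra|].
  unfold Rdiv. rewrite Rmult_assoc, Rinv_l, Rmult_1_r by lra.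
  eapply Rle_trans; [exact B|].
  rewrite (Rmult_assoc eps (Cmod (w - z))), (Rmult_comm (Cmod (w - z))), <- Rmult_assoc.
  apply Rmult_le_compat_r; [exact P0|]. apply Rmult_le_compat_l; lra.
Qed.

Lemma pderiv_bound (q : R -> C) (t : R) (l : C) :
  pderiv q t l -> exists delta : R, 0 < delta /\
    forall s : R, Rabs (s - t) < delta ->
      Cmod (q s - q t) <= (Cmod l + 1) * Rabs (s - t).
Proof.
  intros H. destruct (H 1 Rlt_0_1) as [d [Hd Hw]].
  exists d. split; [exact Hd|]. intros s Hs. specialize (Hw s Hs).
  replace (q s - q t)%C with ((q s - q t - l * RtoC (s - t)) + l * RtoC (s - t))%C by ring.
  eapply Rle_trans; [apply Cmod_triangle|]. rewrite Cmod_mult, Cmod_R. lra.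
Qed.

Lemma pderiv_line (a v : C) (t : R) : pderiv (fun s => a + RtoC s * v)%C t v.
Proof.
  intros eps Heps. exists 1. split; [lra|]. intros s _.
  replace (a + s * v - (a + t * v) - v * (s - t)%R)%C with (RtoC 0)
    by (rewrite RtoC_minus; ring).
  rewrite Cmod_0. apply Rmult_le_pos; [lra | apply Rabs_pos].
Qed.

Lemma pderiv_comp (f : C -> C) (q : R -> C) (t : R) (l v : C) :
  cderiv f (q t) l -> pderiv q t v -> pderiv (fun s => f (q s)) t (l * v)%C.
Proof.
  intros Hf Hq eps Heps.
  pose proof (Cmod_ge_0 l) as Pl. pose proof (Cmod_ge_0 v) as Pv.
  set (e1 := eps / 2 / (Cmod v + 1)). set (e2 := eps / 2 / (Cmod l + 1)).
  assert (0 < e1) as He1 by (apply Rdiv_lt_0_compat; lra).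
  assert (0 < e2) as He2 by (apply Rdiv_lt_0_compat; lra).
  destruct (Hf e1 He1) as [d1 [Hd1 H1]].
  destruct (Hq e2 He2) as [d2 [Hd2 H2]].
  destruct (pderiv_bound q t v Hq) as [d3 [Hd3 H3]].
  exists (Rmin (Rmin d2 d3) (d1 / (Cmod v + 1))). split.
  { apply Rmin_pos; [now apply Rmin_pos | apply Rdiv_lt_0_compat; lra]. }
  intros s Hs.
  assert (Rabs (s - t) < d2 /\ Rabs (s - t) < d3 /\ Rabs (s - t) < d1 / (Cmod v + 1))
    as (S2 & S3 & S1).
  { pose proof (Rmin_l (Rmin d2 d3) (d1 / (Cmod v + 1))).
    pose proof (Rmin_r (Rmin d2 d3) (d1 / (Cmod v + 1))).
    pose proof (Rmin_l d2 d3). pose proof (Rmin_r d2 d3). lra. }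
  specialize (H2 s S2). specialize (H3 s S3).
  assert (Cmod (q s - q t) < d1) as Q1.
  { eapply Rle_lt_trans; [exact H3|].
    apply Rmult_lt_compat_l with (r := Cmod v + 1) in S1; [|lra].
    replace ((Cmod v + 1) * (d1 / (Cmod v + 1))) with d1 in S1 by (field; lra).
    exact S1. }
  specialize (H1 (q s) Q1).
  replace (f (q s) - f (q t) - l * v * RtoC (s - t))%C
    with ((f (q s) - f (q t) - l * (q s - q t)) + l * (q s - q t - v * RtoC (s - t)))%C
    by ring.
  eapply Rle_trans; [apply Cmod_triangle|]. rewrite (Cmod_mult l).
  pose proof (Rabs_pos (s - t)) as Ps.
  assert (e1 * Cmod (q s - q t) <= eps / 2 * Rabs (s - t)) as B1.
  { apply Rle_trans with (e1 * ((Cmod v + 1) * Rabs (s - t))).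
    - apply Rmult_le_compat_l; lra.
    - unfold e1. right. field. lra. }
  assert (Cmod l * Cmod (q s - q t - v * RtoC (s - t)) <= eps / 2 * Rabs (s - t)) as B2.
  { apply Rle_trans with ((Cmod l + 1) * (e2 * Rabs (s - t))).
    - apply Rmult_le_compat; try lra. apply Cmod_ge_0.
    - unfold e2. right. field. lra. }
  lra.
Qed.

Lemma pderiv_Re_Im (q : R -> C) (t : R) (l : C) :
  pderiv q t l ->
  is_derive (fun s => Re (q s)) t (Re l) /\ is_derive (fun s => Im (q s)) t (Im l).
Proof.
  intros H.
  assert (forall g : R -> R, forall m : R,
    (forall s, Rabs (g s - g t - m * (s - t)) <= Cmod (q s - q t - l * RtoC (s - t))) ->
    is_derive g t m) as K.
  { intros g m Hg. apply is_derive_Reals. intros eps Heps.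
    destruct (H (eps / 2)) as [d [Hd Hs]]; [lra|].
    exists (mkposreal d Hd). intros h Hh Hhd. simpl in Hhd.
    specialize (Hs (t + h)). specialize (Hg (t + h)).
    replace (t + h - t) with h in Hs, Hg by ring. specialize (Hs Hhd).
    assert (0 < Rabs h) as Ph by now apply Rabs_pos_lt.
    replace ((g (t + h) - g t) / h - m) with ((g (t + h) - g t - m * h) / h) by now field.
    unfold Rdiv. rewrite Rabs_mult, Rabs_inv.
    apply Rmult_lt_reg_r with (Rabs h); [exact Ph|].
    rewrite Rmult_assoc, Rinv_l, Rmult_1_r by lra. nra. }
  split; apply K; intros s.
  - eapply Rle_trans; [|apply re_le_Cmod]. right. f_equal.
    destruct (q s), (q t), l; simpl; ring.
  - eapply Rle_trans; [|apply Rmax_Cmod]. eapply Rle_trans; [|apply Rmax_r].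
    right. f_equal. destruct (q s), (q t), l; simpl; ring.
Qed.

(** * Termwise differentiation of power series *)

Lemma series_terms_bounded (a : nat -> C) (l : C) :
  is_series (V := C_NormedModule) a l -> exists M : R, forall n : nat, Cmod (a n) <= M.
Proof.
  intros H.
  destruct (filterlim_bounded (V := C_NormedModule) (sum_n a)) as [M HM].
  { exists l. exact H. }
  exists (2 * M). intros n. destruct n as [|n].
  - specialize (HM 0%nat). rewrite sum_O in HM. change (Cmod (a 0%nat) <= M) in HM.
    pose proof (Cmod_ge_0 (a 0%nat)). lra.
  - pose proof (HM n) as H1. pose proof (HM (S n)) as H2. rewrite sum_Sn in H2.
    change (Cmod (sum_n a n) <= M) in H1. change (Cmod (sum_n a n + a (S n)) <= M) in H2.
    replace (a (S n)) with ((sum_n a n + a (S n)) - sum_n a n)%C by ring.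
    eapply Rle_trans; [apply Cmod_triangle_minus|]. lra.
Qed.

Lemma series_bound (a : nat -> C) (b : nat -> R) (l : C) (L : R) :
  is_series (V := C_NormedModule) a l -> is_series b L ->
  (forall n, Cmod (a n) <= b n) -> Cmod l <= L.
Proof.
  intros Ha Hb Hab.
  assert (forall n, Cmod (sum_n a n) <= sum_n b n) as Hs.
  { induction n as [|n IH].
    - rewrite !sum_O. apply Hab.
    - rewrite !sum_Sn.
      change (Cmod (sum_n a n + a (S n)) <= sum_n b n + b (S n)).
      eapply Rle_trans; [apply Cmod_triangle|]. apply Rplus_le_compat; auto. }
  assert (Rbar_le (Cmod l) L) as H; [|exact H].
  apply (filterlim_le (F := eventually) (fun n => Cmod (sum_n a n)) (sum_n b)).
  - exists 0%nat. intros n _. apply Hs.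
  - apply (filterlim_comp _ _ _ (sum_n a) (fun z : C => Cmod z) eventually
             (locally (T := C_NormedModule) l)); [exact Ha|].
    exact (filterlim_norm (V := C_NormedModule) l).
  - exact Hb.
Qed.

Lemma geometric_half (A : R) : is_series (fun n => A * (1 / 2) ^ n) (A * 2).
Proof.
  replace (A * 2) with (A * / (1 - 1 / 2)) by field.
  apply (is_series_scal (V := R_NormedModule) A). apply is_series_geom.
  rewrite Rabs_pos_eq; lra.
Qed.

Lemma INR_le_pow2 (n : nat) : INR (S n) <= 2 ^ n.
Proof.
  induction n as [|n IH]; [simpl; lra|]. rewrite S_INR.
  pose proof (pos_INR n). rewrite S_INR in IH. rewrite S_INR. simpl. lra.
Qed.

(** If [A_n] is the remainder on the left then
    [A_(n+1) = y A_n + n x^(n-1) (y - x)^2]; the constant [4 ^ S n] is crude but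
    makes the induction immediate. *)
Lemma power_remainder (s : R) (x y : C) (n : nat) :
  Cmod x <= s -> Cmod y <= s ->
  Cmod (y ^ S (S n) - x ^ S (S n) - RtoC (INR (S (S n))) * (y - x) * x ^ S n)
    <= 4 ^ S n * s ^ n * Cmod (y - x) ^ 2.
Proof.
  intros Hx Hy. pose proof (Cmod_ge_0 x) as Px. pose proof (Cmod_ge_0 y) as Py.
  induction n as [|n IH].
  - replace (y ^ 2 - x ^ 2 - RtoC (INR 2) * (y - x) * x ^ 1)%C
      with ((y - x) ^ 2)%C by (simpl (INR 2); rewrite RtoC_plus; simpl; ring).
    rewrite Cmod_pow. pose proof (pow2_ge_0 (Cmod (y - x))). simpl in *. lra.
  - set (m := S (S n)) in *.
    replace (y ^ S m - x ^ S m - RtoC (INR (S m)) * (y - x) * x ^ m)%C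
      with (y * (y ^ m - x ^ m - RtoC (INR m) * (y - x) * x ^ S n)
            + RtoC (INR m) * x ^ S n * (y - x) ^ 2)%C
      by (rewrite (S_INR m), RtoC_plus; unfold m; simpl; ring).
    eapply Rle_trans; [apply Cmod_triangle|].
    rewrite !Cmod_mult, !Cmod_pow, Cmod_R, Rabs_pos_eq by apply pos_INR.
    set (D := Cmod (y - x) ^ 2) in *.
    assert (0 <= D) as PD by apply pow2_ge_0.
    assert (0 <= 4 ^ S n * s ^ n) as P4.
    { apply Rmult_le_pos; apply pow_le; lra. }
    assert (Cmod x ^ S n <= s ^ S n) as Hxn by (apply pow_incr; lra).
    assert (INR m <= 3 * 4 ^ S n) as Hm.
    { pose proof (INR_le_pow2 (S n)) as H2. fold m in H2.
      assert (2 ^ S n <= 4 ^ S n) by (apply pow_incr; lra).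
      pose proof (pow_lt 4 (S n)). lra. }
    apply Rle_trans with (s * (4 ^ S n * s ^ n * D) + 3 * 4 ^ S n * s ^ S n * D).
    + apply Rplus_le_compat.
      * apply Rmult_le_compat; auto. apply Cmod_ge_0.
      * apply Rmult_le_compat_r; [exact PD|].
        apply Rmult_le_compat; auto using pos_INR. now apply pow_le.
    + right. unfold m. simpl. ring.
Qed.

Lemma pow_n_Cpow (x : C) (n : nat) : pow_n (K := C_Ring) x n = (x ^ n)%C.
Proof. induction n as [|n IH]; [reflexivity|]. simpl. rewrite IH. reflexivity. Qed.

Lemma is_pseries_Cpow (c : nat -> C) (x l : C) :
  is_pseries (K := C_AbsRing) (V := C_NormedModule) c x l <->
  is_series (V := C_NormedModule) (fun n => x ^ n * c n)%C l.
Proof.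
  unfold is_pseries.
  split; apply is_series_ext; intros n; rewrite <- pow_n_Cpow; reflexivity.
Qed.

Definition derived_coef (c : nat -> C) (n : nat) : C :=
  (RtoC (INR (S n)) * c (S n))%C.

(** Convergence at [rho = r/2] gives [|c_n| <= M / rho^n].  On the much smaller
    disc of radius [rho/8] all the series needed are then dominated by
    geometric ones, even after the losses [2^n] and [4^n] of the crude bounds
    above, and the remainders add up to [O(|y - x|^2)]. *)
Lemma pseries_cderiv (c : nat -> C) (r : R) (F : C -> C) :
  0 < r ->
  (forall x, Cmod x < r -> is_pseries (K := C_AbsRing) (V := C_NormedModule) c x (F x)) ->
  exists s : R, 0 < s /\ forall x, Cmod x < s ->
    exists l : C, cderiv F x l /\
      is_pseries (K := C_AbsRing) (V := C_NormedModule) (derived_coef c) x l.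
Proof.
  intros Hr HF.
  set (rho := r / 2). assert (0 < rho < r) as Hrho by (unfold rho; lra).
  assert (exists M, 0 <= M /\ forall n, Cmod (c n) <= M / rho ^ n) as [M [HM Hc]].
  { assert (Cmod (RtoC rho) < r) as Hrr by (rewrite Cmod_R, Rabs_pos_eq; lra).
    destruct (series_terms_bounded _ _ (proj1 (is_pseries_Cpow _ _ _) (HF _ Hrr)))
      as [M HM].
    assert (forall n, 0 < rho ^ n) as Pn by (intros n; apply pow_lt; lra).
    exists M. split.
    - eapply Rle_trans; [apply Cmod_ge_0 | apply (HM 0%nat)].
    - intros n. specialize (HM n). specialize (Pn n).
      rewrite Cmod_mult, Cmod_pow, Cmod_R, Rabs_pos_eq in HM by lra.
      apply Rmult_le_reg_l with (rho ^ n); [exact Pn|].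
      replace (rho ^ n * (M / rho ^ n)) with M by (field; lra). exact HM. }
  set (s := rho / 8). assert (0 < s) as Hs by (unfold s; lra).
  assert (s < r) as Hsr by (unfold s; lra).
  assert (forall n, s ^ n = rho ^ n * (1 / 8) ^ n) as Hsn.
  { intros n. unfold s. rewrite <- Rpow_mult_distr. f_equal. lra. }
  exists s. split; [exact Hs|]. intros x Hx.
  pose proof (Cmod_ge_0 x) as Px.
  assert (forall n, Cmod (x ^ n * derived_coef c n) <= M / rho * (1 / 2) ^ n) as HB.
  { intros n. unfold derived_coef. rewrite !Cmod_mult, Cmod_pow, Cmod_R.
    rewrite Rabs_pos_eq by apply pos_INR.
    pose proof (INR_le_pow2 n) as H2. pose proof (pos_INR (S n)) as P2.
    specialize (Hc (S n)).
    assert (0 < rho ^ n) as Pn by (apply pow_lt; lra).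
    assert (Cmod x ^ n <= s ^ n) as Hxn by (apply pow_incr; lra).
    apply Rle_trans with (s ^ n * (2 ^ n * (M / rho ^ S n))).
    - repeat (apply Rmult_le_compat; auto using pow_le, Cmod_ge_0, Rmult_le_pos).
    - rewrite Hsn.
      replace (rho ^ n * (1 / 8) ^ n * (2 ^ n * (M / rho ^ S n)))
        with (M / rho * ((1 / 8) ^ n * 2 ^ n)) by (simpl; field; lra).
      rewrite <- Rpow_mult_distr. apply Rmult_le_compat_l.
      + apply Rdiv_le_0_compat; lra.
      + apply pow_incr. lra. }
  assert (exists l : C,
    is_series (V := C_NormedModule) (fun n => x ^ n * derived_coef c n)%C l) as [l Hl].
  { apply (ex_series_le (V := C_CompleteNormedModule) _ (fun n => M / rho * (1 / 2) ^ n)).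
    - exact HB.
    - eexists. apply geometric_half. }
  exists l. split; [|now apply is_pseries_Cpow].
  assert (is_series (V := C_NormedModule) (fun n => RtoC (INR n) * x ^ pred n * c n)%C l) as Hl'.
  { apply (is_series_decr_1 (V := C_NormedModule)
             (fun n => RtoC (INR n) * x ^ pred n * c n)%C l).
    assert (l = (l + - (RtoC (INR 0) * x ^ pred 0 * c 0%nat))%C) as El by (simpl; ring).
    rewrite El in Hl.
    apply (is_series_ext (V := C_NormedModule) (fun n => x ^ n * derived_coef c n)%C);
      [|exact Hl].
    intros n. unfold derived_coef. simpl pred.
    change (x ^ n * (INR (S n) * c (S n)) = INR (S n) * x ^ n * c (S n))%C. ring. }
  set (A := 4 * (4 * M / rho ^ 2)).
  assert (forall y, Cmod y <= s -> Cmod (F y - F x - l * (y - x)) <= A * 2 * Cmod (y - x) ^ 2)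
    as HQ.
  { intros y Hy.
    assert (is_series (V := C_NormedModule)
      (fun n => y ^ n * c n - x ^ n * c n - (y - x) * (RtoC (INR n) * x ^ pred n * c n))%C
      (F y - F x - (y - x) * l)%C) as HS.
    { apply (is_series_minus (V := C_NormedModule)).
      - apply (is_series_minus (V := C_NormedModule)); apply is_pseries_Cpow, HF; lra.
      - apply (is_series_scal (V := C_NormedModule)). exact Hl'. }
    replace (l * (y - x))%C with ((y - x) * l)%C by ring.
    replace (A * 2 * Cmod (y - x) ^ 2) with (A * Cmod (y - x) ^ 2 * 2) by ring.
    eapply series_bound; [exact HS | apply geometric_half |].
    assert (0 <= A) as PA.
    { unfold A. apply Rmult_le_pos; [lra|]. apply Rdiv_le_0_compat; [lra|].
      apply pow_lt; lra. }
    assert (0 <= A * Cmod (y - x) ^ 2) as PAD.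
    { apply Rmult_le_pos; [exact PA | apply pow2_ge_0]. }
    intros n. destruct n as [|[|n]].
    - replace (y ^ 0 * c 0%nat - x ^ 0 * c 0%nat
               - (y - x) * (RtoC (INR 0) * x ^ pred 0 * c 0%nat))%C with (RtoC 0)
        by (simpl; ring).
      rewrite Cmod_0. simpl. lra.
    - replace (y ^ 1 * c 1%nat - x ^ 1 * c 1%nat
               - (y - x) * (RtoC (INR 1) * x ^ pred 1 * c 1%nat))%C with (RtoC 0)
        by (simpl; ring).
      rewrite Cmod_0. simpl. lra.
    - set (m := S (S n)) in *.
      replace (y ^ m * c m - x ^ m * c m
               - (y - x) * (RtoC (INR m) * x ^ pred m * c m))%C
        with ((y ^ m - x ^ m - RtoC (INR m) * (y - x) * x ^ S n) * c m)%C
        by (unfold m; simpl pred; ring).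
      rewrite Cmod_mult.
      pose proof (power_remainder s x y n ltac:(lra) Hy) as HR. fold m in HR.
      specialize (Hc m).
      assert (0 < rho ^ n) as Pn by (apply pow_lt; lra).
      eapply Rle_trans.
      + apply Rmult_le_compat; [apply Cmod_ge_0 | apply Cmod_ge_0 | exact HR | exact Hc].
      + rewrite Hsn. unfold m, A.
        replace (4 ^ S n * (rho ^ n * (1 / 8) ^ n) * Cmod (y - x) ^ 2 * (M / rho ^ S (S n)))
          with (4 * M / rho ^ 2 * Cmod (y - x) ^ 2 * (4 ^ n * (1 / 8) ^ n))
          by (simpl; field; lra).
        rewrite <- Rpow_mult_distr. replace (4 * (1 / 8)) with (1 / 2) by lra.
        right. simpl. field. lra. }
  intros eps Heps.
  assert (0 <= A) as PA.
  { unfold A. apply Rmult_le_pos; [lra|]. apply Rdiv_le_0_compat; [lra|].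
    apply pow_lt; lra. }
  exists (Rmin (s - Cmod x) (eps / (A * 2 + 1))). split.
  { apply Rmin_pos; [lra | apply Rdiv_lt_0_compat; lra]. }
  intros y Hy.
  assert (Cmod y <= s) as Hys.
  { replace y with ((y - x) + x)%C by ring. eapply Rle_trans; [apply Cmod_triangle|].
    pose proof (Rmin_l (s - Cmod x) (eps / (A * 2 + 1))). lra. }
  eapply Rle_trans; [apply HQ, Hys|].
  pose proof (Cmod_ge_0 (y - x)) as PD.
  assert (A * 2 * Cmod (y - x) <= eps) as HE.
  { assert (Cmod (y - x) <= eps / (A * 2 + 1)) as H1
      by (pose proof (Rmin_r (s - Cmod x) (eps / (A * 2 + 1))); lra).
    apply Rmult_le_compat_l with (r := A * 2 + 1) in H1; [|lra].
    replace ((A * 2 + 1) * (eps / (A * 2 + 1))) with eps in H1 by (field; lra). lra. }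
  simpl. rewrite Rmult_1_r, <- Rmult_assoc. now apply Rmult_le_compat_r.
Qed.

Lemma cderiv_translate (f : C -> C) (z x l : C) :
  cderiv (fun h => f (z + h)%C) x l -> cderiv f (z + x)%C l.
Proof.
  intros H eps Heps. destruct (H eps Heps) as [d [Hd Hw]].
  exists d. split; [exact Hd|]. intros w Hwd.
  specialize (Hw (w - z)%C).
  replace (w - z - x)%C with (w - (z + x))%C in Hw by ring.
  replace (z + (w - z))%C with w in Hw by ring. now apply Hw.
Qed.

Lemma analytic_derivative (f : C -> C) (z : C) (c : nat -> C) (r : R) :
  0 < r ->
  (forall w, Cmod (w - z) < r ->
    is_pseries (K := C_AbsRing) (V := C_NormedModule) c (w - z)%C (f w)) ->
  exists s : R, 0 < s /\ forall w, Cmod (w - z) < s ->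
    cderiv f w (C_derive f w) /\
    is_pseries (K := C_AbsRing) (V := C_NormedModule)
      (derived_coef c) (w - z)%C (C_derive f w).
Proof.
  intros Hr Hf.
  destruct (pseries_cderiv c r (fun h => f (z + h)%C) Hr) as [s [Hs H]].
  { intros x Hx. pose proof (Hf (z + x)%C) as Hw.
    replace (z + x - z)%C with x in Hw by ring. now apply Hw. }
  exists s. split; [exact Hs|]. intros w Hw. destruct (H (w - z)%C Hw) as [l [Hl Hp]].
  apply cderiv_translate in Hl. replace (z + (w - z))%C with w in Hl by ring.
  rewrite (cderiv_C_derive f w l Hl). now split.
Qed.

Lemma analytic_cderiv (f : C -> C) (z : C) :
  analytic_in_disk f -> disk z -> cderiv f z (C_derive f z).
Proof.
  intros Hf Hz. destruct (Hf z Hz) as [c [r [Hr H]]].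
  destruct (analytic_derivative f z c r Hr H) as [s [Hs Hw]].
  apply Hw. replace (z - z)%C with (RtoC 0) by ring. now rewrite Cmod_0.
Qed.

Lemma analytic_C_derive (f : C -> C) :
  analytic_in_disk f -> analytic_in_disk (C_derive f).
Proof.
  intros Hf z Hz. destruct (Hf z Hz) as [c [r [Hr H]]].
  destruct (analytic_derivative f z c r Hr H) as [s [Hs Hw]].
  exists (derived_coef c), s. split; [exact Hs|]. intros w W. now apply Hw.
Qed.

(** * A comparison principle for complex paths *)

(** Differentiability is only available in the open interval where this is
    applied, and the mean value point has to lie there too. *)
Lemma MVT_open (u du : R -> R) (a b : R) :
  a < b ->
  (forall x, a < x < b -> is_derive u x (du x)) ->
  (forall x, a <= x <= b -> continuity_pt u x) ->
  exists c, a < c < b /\ u b - u a = du c * (b - a).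
Proof.
  intros Hab Hd Hc.
  destruct (MVT u id a b
    (fun x Hx => exist _ (du x) (proj1 (is_derive_Reals u x (du x)) (Hd x Hx)))
    (fun x _ => derivable_pt_id x) Hab Hc
    (fun x _ => derivable_continuous_pt id x (derivable_pt_id x))) as [c [Hc1 Heq]].
  exists c. split; [exact Hc1|]. unfold derive_pt at 1 in Heq. simpl in Heq.
  rewrite derive_pt_id in Heq. unfold id in Heq. lra.
Qed.

(** A value above both end values would force slopes of opposite signs,
    positive then negative, hence a negative second derivative between them. *)
Lemma convex_le_max (u u1 u2 : R -> R) (t : R) :
  0 <= t <= 1 ->
  (forall x, 0 <= x <= 1 -> continuity_pt u x) ->
  (forall x, 0 < x < 1 -> is_derive u x (u1 x) /\ is_derive u1 x (u2 x) /\ 0 <= u2 x) ->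
  u t <= Rmax (u 0) (u 1).
Proof.
  intros Ht Hc Hd. apply Rnot_lt_le. intros Hlt.
  pose proof (Rmax_l (u 0) (u 1)) as ML. pose proof (Rmax_r (u 0) (u 1)) as MR.
  assert (0 < t < 1) as Ht'.
  { destruct (Req_dec t 0) as [->|]; [lra|]. destruct (Req_dec t 1) as [->|]; lra. }
  destruct (MVT_open u u1 0 t) as [c [Hc1 Ec]]; [lra | | intros; apply Hc; lra |].
  { intros x Hx. apply Hd. lra. }
  destruct (MVT_open u u1 t 1) as [d [Hd1 Ed]]; [lra | | intros; apply Hc; lra |].
  { intros x Hx. apply Hd. lra. }
  destruct (MVT_open u1 u2 c d) as [e [He1 Ee]]; [lra | | |].
  { intros x Hx. apply Hd. lra. }
  { intros x Hx. apply derivable_continuous_pt. exists (u2 x).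
    apply is_derive_Reals. apply Hd. lra. }
  destruct (Hd e) as [_ [_ H2]]; [lra|].
  assert (0 < u1 c) by nra. assert (u1 d < 0) by nra. nra.
Qed.

Lemma last_nonpositive (D : R -> R) (b : R) :
  0 <= b -> (forall x, 0 <= x <= b -> continuity_pt D x) -> D 0 <= 0 -> 0 < D b ->
  exists x0, 0 <= x0 < b /\ D x0 <= 0 /\ forall x, x0 < x <= b -> 0 < D x.
Proof.
  intros Hb HD H0 Hb0.
  destruct (completeness (fun x => 0 <= x <= b /\ D x <= 0)) as [m [Hub Hlub]].
  { exists b. intros x [Hx _]. lra. }
  { exists 0. split; lra. }
  assert (0 <= m) as Hm0 by (apply Hub; split; lra).
  assert (m <= b) as Hmb by (apply Hlub; intros x [Hx _]; lra).
  assert (D m <= 0) as HDm.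
  { apply Rnot_lt_le. intros Hpos.
    destruct (HD m (conj Hm0 Hmb) (D m) Hpos) as [d [Hd Hc]].
    assert (m <= m - d) as Habs; [|lra].
    apply Hlub. intros x [Hx HDx]. apply Rnot_lt_le. intros Hlt.
    assert (x <= m) as Hxm by (apply Hub; now split).
    destruct (Req_dec x m) as [->|Hne]; [lra|].
    assert (Rabs (D x - D m) < D m) as HA.
    { apply Hc. split.
      - split; [exact I | auto].
      - simpl. unfold Rdist. apply Rabs_def1; lra. }
    apply Rabs_def2 in HA. lra. }
  exists m. repeat split.
  - exact Hm0.
  - destruct (Req_dec m b) as [->|]; lra.
  - exact HDm.
  - intros x Hx. apply Rnot_le_lt. intros Hle.
    assert (x <= m) by (apply Hub; split; lra). lra.
Qed.

Lemma Cmod_path_continuous (q : R -> C) (t L : R) :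
  0 <= L ->
  (exists delta : R, 0 < delta /\
    forall s : R, Rabs (s - t) < delta -> Cmod (q s - q t) <= L * Rabs (s - t)) ->
  continuity_pt (fun s => Cmod (q s)) t.
Proof.
  intros HL [d [Hd Hq]] eps Heps.
  exists (Rmin d (eps / (L + 1))). split.
  { apply Rmin_pos; [exact Hd | apply Rdiv_lt_0_compat; lra]. }
  intros s [_ Hs]. simpl in *. unfold Rdist in *.
  pose proof (Rmin_l d (eps / (L + 1))).
  pose proof (Rmin_r d (eps / (L + 1))).
  specialize (Hq s ltac:(lra)).
  assert ((L + 1) * Rabs (s - t) < eps) as HB.
  { apply Rlt_le_trans with ((L + 1) * (eps / (L + 1))).
    - apply Rmult_lt_compat_l; lra.
    - right. field. lra. }
  pose proof (Rabs_pos (s - t)).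
  pose proof (Cmod_triangle_inv (q s) (q t)).
  pose proof (Cmod_triangle_inv (q t) (q s)) as H3. rewrite (Cmod_sym (q t) (q s)) in H3.
  apply Rabs_def1; lra.
Qed.

Lemma dot_le_Cmod (a b : C) : Re a * Re b + Im a * Im b <= Cmod a * Cmod b.
Proof.
  rewrite <- (Cmod_conj a), <- Cmod_mult.
  eapply Rle_trans; [|apply re_le_Cmod]. eapply Rle_trans; [|apply Rle_abs].
  right. destruct a, b; simpl; ring.
Qed.

Lemma Cmod_path_derive (q : R -> C) (t : R) (l : C) :
  pderiv q t l -> q t <> 0 ->
  exists m : R, is_derive (fun s => Cmod (q s)) t m /\ m <= Cmod l.
Proof.
  intros H H0. destruct (pderiv_Re_Im q t l H) as [HR HI].
  assert (0 < Cmod (q t)) as P by now apply Cmod_gt_0.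
  set (S := Re (q t) * Re l + Im (q t) * Im l).
  exists (S / Cmod (q t)). split.
  - unfold Cmod, S.
    replace ((Re (q t) * Re l + Im (q t) * Im l) / sqrt (fst (q t) ^ 2 + snd (q t) ^ 2))
      with ((INR 2 * Re l * Re (q t) ^ pred 2 + INR 2 * Im l * Im (q t) ^ pred 2)
            / (2 * sqrt (fst (q t) ^ 2 + snd (q t) ^ 2))).
    + apply (is_derive_sqrt (fun s => Re (q s) ^ 2 + Im (q s) ^ 2)).
      * apply (is_derive_plus (V := R_NormedModule)
                 (fun s => Re (q s) ^ 2) (fun s => Im (q s) ^ 2));
          apply is_derive_pow; assumption.
      * apply Rnot_le_lt. intros Hle. unfold Cmod in P.
        rewrite sqrt_neg_0 in P by exact Hle. lra.
    + simpl. field. unfold Cmod in P. simpl in P. lra.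
  - apply Rmult_le_reg_r with (Cmod (q t)); [exact P|].
    unfold Rdiv. rewrite Rmult_assoc, Rinv_l, Rmult_1_r by lra.
    rewrite (Rmult_comm (Cmod l)). apply dot_le_Cmod.
Qed.

(** A Gronwall inequality for [D = |q| - y].  Only the part of the path where
    [D > 0] matters: there [q] does not vanish, so [|q|] is differentiable, and
    [D' <= K D].  If [D] were positive at [b], then after its last nonpositive
    value [D exp (- K x)] would be nonincreasing, yet grow from a nonpositive
    to a positive value. *)
Lemma comparison (q dq : R -> C) (y dy : R -> R) (K b : R) :
  0 <= b ->
  (forall x, 0 <= x <= b -> pderiv q x (dq x)) ->
  (forall x, 0 <= x <= b -> is_derive y x (dy x)) ->
  (forall x, 0 <= x <= b -> 0 <= y x) ->
  Cmod (q 0) <= y 0 ->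
  (forall x, 0 <= x <= b -> y x < Cmod (q x) ->
    Cmod (dq x) <= dy x + K * (Cmod (q x) - y x)) ->
  Cmod (q b) <= y b.
Proof.
  intros Hb Hq Hy Hpos H0 Hineq. apply Rnot_lt_le. intros Hlt.
  set (D := fun x => Cmod (q x) - y x).
  assert (forall x, 0 <= x <= b -> continuity_pt D x) as HDc.
  { intros x Hx. apply continuity_pt_minus.
    - apply Cmod_path_continuous with (Cmod (dq x) + 1).
      + pose proof (Cmod_ge_0 (dq x)). lra.
      + now apply pderiv_bound, Hq.
    - apply derivable_continuous_pt. exists (dy x). apply is_derive_Reals. now apply Hy. }
  destruct (last_nonpositive D b Hb HDc) as [x0 [Hx0 [HD0 HDpos]]];
    [unfold D; lra | unfold D; lra |].
  assert (forall x, exists m : R, x0 < x < b -> is_derive D x m /\ m <= K * D x) as Hder.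
  { intros x. destruct (Rlt_dec x0 x) as [H1|H1]; [|exists 0; lra].
    destruct (Rlt_dec x b) as [H2|H2]; [|exists 0; lra].
    assert (0 <= x <= b) as Hx by lra.
    specialize (HDpos x ltac:(lra)). unfold D in HDpos. specialize (Hpos x Hx).
    destruct (Cmod_path_derive q x (dq x) (Hq x Hx)) as [m [Hm Hle]].
    { apply Cmod_gt_0. lra. }
    exists (m - dy x). intros _. split.
    - apply (is_derive_minus (V := R_NormedModule)); [exact Hm | now apply Hy].
    - specialize (Hineq x Hx ltac:(lra)). unfold D. lra. }
  set (dD := fun x => proj1_sig (constructive_indefinite_description _ (Hder x))).
  assert (forall x, x0 < x < b -> is_derive D x (dD x) /\ dD x <= K * D x) as HdD.
  { intros x. unfold dD.
    destruct (constructive_indefinite_description _ (Hder x)) as [m Hm]. exact Hm. }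
  destruct (MVT_open (fun x => D x * exp (- K * x))
              (fun x => (dD x - K * D x) * exp (- K * x)) x0 b) as [c [Hc Heq]].
  - lra.
  - intros x Hx. destruct (HdD x Hx) as [H1 _].
    replace ((dD x - K * D x) * exp (- K * x))
      with (dD x * exp (- K * x) + D x * (- K * exp (- K * x))) by ring.
    apply (is_derive_mult (K := R_AbsRing) D (fun x => exp (- K * x)) x (dD x));
      [exact H1 | | exact Rmult_comm].
    auto_derive; [exact I | ring].
  - intros x Hx.
    apply continuity_pt_mult; [apply HDc; lra|].
    apply derivable_continuous_pt. reg.
  - assert (0 < D b * exp (- K * b)) as P1.
    { apply Rmult_lt_0_compat; [unfold D; lra | apply exp_pos]. }
    assert (D x0 * exp (- K * x0) <= 0) as P2.
    { pose proof (exp_pos (- K * x0)). nra. }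
    destruct (HdD c Hc) as [_ Hd]. pose proof (exp_pos (- K * c)) as Pe.
    assert (0 <= (K * D c - dD c) * exp (- K * c) * (b - x0)).
    { apply Rmult_le_pos; [apply Rmult_le_pos; lra | lra]. }
    nra.
Qed.

(** * Perturbations of a linear map of the disk *)

Lemma pderiv_minus_const (q : R -> C) (t : R) (l a : C) :
  pderiv q t l -> pderiv (fun s => q s - a)%C t l.
Proof.
  intros H eps Heps. destruct (H eps Heps) as [d [Hd Hs]].
  exists d. split; [exact Hd|]. intros s S.
  replace (q s - a - (q t - a))%C with (q s - q t)%C by ring. now apply Hs.
Qed.

Lemma disk_segment (z w : C) (t : R) :
  disk z -> disk w -> 0 <= t <= 1 -> disk (z + RtoC t * (w - z))%C.
Proof.
  unfold disk. intros Hz Hw Ht.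
  replace (z + t * (w - z))%C with (RtoC (1 - t) * z + RtoC t * w)%C
    by (rewrite RtoC_minus; ring).
  eapply Rle_lt_trans; [apply Cmod_triangle|].
  rewrite !Cmod_mult, !Cmod_R, !Rabs_pos_eq by lra.
  pose proof (Rmult_le_compat_l (1 - t) _ _ ltac:(lra) (Rmax_l (Cmod z) (Cmod w))).
  pose proof (Rmult_le_compat_l t _ _ ltac:(lra) (Rmax_r (Cmod z) (Cmod w))).
  pose proof (Rmax_lub_lt _ _ _ Hz Hw). lra.
Qed.

(** The mean value inequality, as the comparison of a segment path with a
    linear function. *)
Lemma lipschitz_disk (f f' : C -> C) (k : R) :
  (forall z, disk z -> cderiv f z (f' z) /\ Cmod (f' z) <= k) ->
  forall z w, disk z -> disk w -> Cmod (f z - f w) <= k * Cmod (z - w).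
Proof.
  intros Hf z w Hz Hw.
  assert (0 <= k) as Hk.
  { destruct (Hf z Hz) as [_ H]. pose proof (Cmod_ge_0 (f' z)). lra. }
  pose proof (Cmod_ge_0 (z - w)) as P.
  pose (g := fun s : R => (w + RtoC s * (z - w))%C).
  pose proof (comparison (fun s => f (g s) - f w)%C (fun s => f' (g s) * (z - w))%C
    (fun s => k * Cmod (z - w) * s) (fun _ => k * Cmod (z - w)) 0 1) as H.
  assert (g 1 = z) as G1 by (unfold g; ring).
  assert (g 0 = w) as G0 by (unfold g; ring).
  cbv beta in H. rewrite G1, G0, Rmult_1_r in H. apply H; clear H.
  - lra.
  - intros x Hx. apply pderiv_minus_const. apply pderiv_comp.
    + apply Hf. now apply disk_segment.
    + apply pderiv_line.
  - intros x _. auto_derive; [exact I | ring].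
  - intros x Hx. apply Rmult_le_pos; [now apply Rmult_le_pos | lra].
  - replace (f w - f w)%C with (RtoC 0) by ring. rewrite Cmod_0. lra.
  - intros x Hx _. rewrite Cmod_mult, Rmult_0_l, Rplus_0_r.
    apply Rmult_le_compat_r; [exact P|]. apply Hf. now apply disk_segment.
Qed.

Definition near_linear (f : C -> C) (m : C) : Prop :=
  m <> 0 /\ forall z w, disk z -> disk w ->
    Cmod (f z - f w - m * (z - w)) <= 3 / 4 * Cmod m * Cmod (z - w).

Lemma near_linear_lower (f : C -> C) (m z w : C) :
  near_linear f m -> disk z -> disk w ->
  Cmod m * Cmod (z - w) <= 4 * Cmod (f z - f w).
Proof.
  intros [_ Hf] Hz Hw. specialize (Hf z w Hz Hw).
  pose proof (Cmod_triangle_inv (m * (z - w)) (f z - f w)) as H.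
  rewrite (Cmod_sym (m * (z - w))), Cmod_mult in H. lra.
Qed.

Lemma near_linear_upper (f : C -> C) (m z w : C) :
  near_linear f m -> disk z -> disk w ->
  Cmod (f z - f w) <= 2 * Cmod m * Cmod (z - w).
Proof.
  intros [_ Hf] Hz Hw. specialize (Hf z w Hz Hw).
  pose proof (Cmod_triangle_inv (f z - f w) (m * (z - w))) as H.
  rewrite Cmod_mult in H.
  assert (0 <= Cmod m * Cmod (z - w)) by (apply Rmult_le_pos; apply Cmod_ge_0). lra.
Qed.

Lemma near_linear_univalent (f : C -> C) (m : C) : near_linear f m -> univalent f.
Proof.
  intros Hf z w Hz Hw E. pose proof (near_linear_lower f m z w Hf Hz Hw) as H.
  rewrite E in H. replace (f w - f w)%C with (RtoC 0) in H by ring. rewrite Cmod_0 in H.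
  destruct Hf as [Hm _]. apply Cmod_gt_0 in Hm. pose proof (Cmod_ge_0 (z - w)) as P.
  apply Cminus_eq_0, Cmod_eq_0. nra.
Qed.

Lemma small_is_zero (x k : R) : 0 <= x -> (forall eps, 0 < eps -> x <= k * eps) -> x = 0.
Proof.
  intros Hx H. apply Rle_antisym; [|exact Hx]. apply Rnot_lt_le. intros Hpos.
  pose proof (Rle_abs k) as Hk. pose proof (Rabs_pos k) as Pk.
  specialize (H (x / 2 / (Rabs k + 1))).
  assert (0 < x / 2 / (Rabs k + 1)) as P by (apply Rdiv_lt_0_compat; lra).
  specialize (H P).
  assert ((Rabs k + 1) * (x / 2 / (Rabs k + 1)) = x / 2) as E by (field; lra).
  nra.
Qed.

Lemma contraction_fixed_point (T : C -> C) (z : C) (rho k : R) :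
  0 <= rho -> 0 <= k < 1 ->
  (forall x, Cmod (x - z) <= rho -> Cmod (T x - z) <= rho) ->
  (forall x y, Cmod (x - z) <= rho -> Cmod (y - z) <= rho ->
    Cmod (T x - T y) <= k * Cmod (x - y)) ->
  exists l, Cmod (l - z) <= rho /\ T l = l.
Proof.
  intros Hrho Hk Hball HT.
  pose (x := fun n => Nat.iter n T z).
  assert (forall n, Cmod (x n - z) <= rho) as Hx.
  { induction n as [|n IH].
    - simpl. replace (z - z)%C with (RtoC 0) by ring. now rewrite Cmod_0.
    - simpl. now apply Hball. }
  assert (forall n, Cmod (x (S n) - x n) <= Cmod (T z - z) * k ^ n) as Hstep.
  { induction n as [|n IH].
    - simpl. lra.
    - change (x (S (S n))) with (T (x (S n))). change (x (S n)) with (T (x n)) at 2.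
      eapply Rle_trans; [apply HT; apply Hx|]. simpl pow.
      replace (Cmod (T z - z) * (k * k ^ n)) with (k * (Cmod (T z - z) * k ^ n)) by ring.
      apply Rmult_le_compat_l; lra. }
  assert (exists d : C, is_series (V := C_NormedModule) (fun n => x (S n) - x n)%C d)
    as [d Hd].
  { apply (ex_series_le (V := C_CompleteNormedModule) _
             (fun n => Cmod (T z - z) * k ^ n)); [exact Hstep|].
    apply (ex_series_scal (V := R_NormedModule)). exists (/ (1 - k)).
    apply is_series_geom. rewrite Rabs_pos_eq; lra. }
  assert (forall n, sum_n (G := C_AbelianMonoid) (fun n => x (S n) - x n)%C n
            = (x (S n) - z)%C) as Hsum.
  { induction n as [|n IH].
    - rewrite sum_O. reflexivity.
    - rewrite sum_Sn, IH. change (x (S n) - z + (x (S (S n)) - x (S n)) = x (S (S n)) - z)%C.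
      ring. }
  exists (z + d)%C.
  assert (forall eps, 0 < eps -> exists n, forall j, (n <= j)%nat ->
            Cmod (x (S j) - (z + d)) <= eps) as Hlim.
  { intros eps Heps.
    destruct (proj1 (filterlim_locally_ball_norm (U := C_NormedModule) _ d) Hd
                (mkposreal eps Heps)) as [n Hn].
    exists n. intros j Hj. specialize (Hn j Hj). unfold ball_norm in Hn.
    change (Cmod (sum_n (G := C_AbelianMonoid) (fun n => x (S n) - x n)%C j - d) < eps) in Hn.
    rewrite Hsum in Hn.
    replace (x (S j) - (z + d))%C with (x (S j) - z - d)%C by ring. lra. }
  assert (Cmod (z + d - z) <= rho) as Hin.
  { apply Rnot_lt_le. intros Hlt.
    destruct (Hlim ((Cmod (z + d - z) - rho) / 2)) as [n Hn]; [lra|].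
    specialize (Hn n (le_n n)). rewrite Cmod_sym in Hn. specialize (Hx (S n)).
    pose proof (Cmod_triangle (z + d - x (S n)) (x (S n) - z)) as H.
    replace (z + d - x (S n) + (x (S n) - z))%C with (z + d - z)%C in H by ring. lra. }
  split; [exact Hin|].
  apply Cminus_eq_0, Cmod_eq_0. apply small_is_zero with 2; [apply Cmod_ge_0|].
  intros eps Heps. destruct (Hlim eps Heps) as [n Hn].
  pose proof (Hn n (le_n n)) as H1. pose proof (Hn (S n) (le_S _ _ (le_n n))) as H2.
  pose proof (HT (z + d)%C (x (S n)) Hin (Hx (S n))) as H3.
  change (T (x (S n))) with (x (S (S n))) in H3. rewrite (Cmod_sym (z + d)) in H3.
  pose proof (Cmod_triangle (T (z + d)%C - x (S (S n))) (x (S (S n)) - (z + d))) as H4.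
  replace (T (z + d)%C - x (S (S n)) + (x (S (S n)) - (z + d)))%C
    with (T (z + d)%C - (z + d))%C in H4 by ring.
  pose proof (Cmod_ge_0 (x (S n) - (z + d))). nra.
Qed.

(** Solving [f l = w] is finding a fixed point of [x - (f x - w) / m], which is
    a [3/4]-contraction; the bound on [w - f z] makes it preserve the ball of
    radius [(1 - r)/2] around [z], which stays inside the disk. *)
Lemma near_linear_open (f : C -> C) (m z w : C) (r : R) :
  near_linear f m -> r < 1 -> Cmod z <= r -> Cmod (w - f z) <= Cmod m * (1 - r) / 8 ->
  disk_image f w.
Proof.
  intros [Hm Hf] Hr Hz Hw. pose proof (proj1 (Cmod_gt_0 m) Hm) as Pm.
  set (rho := (1 - r) / 2).
  assert (forall x, Cmod (x - z) <= rho -> disk x) as Hdisk.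
  { intros x Hx. unfold disk. replace x with ((x - z) + z)%C by ring.
    eapply Rle_lt_trans; [apply Cmod_triangle|]. unfold rho in Hx. lra. }
  assert (Cmod (z - z) <= rho) as Hzz.
  { replace (z - z)%C with (RtoC 0) by ring. rewrite Cmod_0. unfold rho. lra. }
  assert (forall x y, Cmod (x - z) <= rho -> Cmod (y - z) <= rho ->
    Cmod ((x - (f x - w) / m) - (y - (f y - w) / m)) <= 3 / 4 * Cmod (x - y)) as HT.
  { intros x y Hx Hy. specialize (Hf x y (Hdisk x Hx) (Hdisk y Hy)).
    replace ((x - (f x - w) / m) - (y - (f y - w) / m))%C
      with (- (f x - f y - m * (x - y)) / m)%C by (field; exact Hm).
    rewrite Cmod_div, Cmod_opp by exact Hm.
    apply Rmult_le_reg_r with (Cmod m); [exact Pm|].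
    unfold Rdiv at 1. rewrite Rmult_assoc, Rinv_l, Rmult_1_r by lra. lra. }
  destruct (contraction_fixed_point (fun x => x - (f x - w) / m)%C z rho (3 / 4))
    as [l [Hl El]].
  - unfold rho. lra.
  - lra.
  - intros x Hx. specialize (HT x z Hx Hzz).
    replace (x - (f x - w) / m - z)%C
      with ((x - (f x - w) / m - (z - (f z - w) / m)) + (w - f z) / m)%C
      by (field; exact Hm).
    eapply Rle_trans; [apply Cmod_triangle|].
    assert (Cmod ((w - f z) / m) <= rho / 4) as HB.
    { rewrite Cmod_div by exact Hm. apply Rmult_le_reg_r with (Cmod m); [exact Pm|].
      unfold Rdiv at 1. rewrite Rmult_assoc, Rinv_l, Rmult_1_r by lra.
      unfold rho. lra. }
    lra.
  - exact HT.
  - exists l. split; [now apply Hdisk|].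
    apply Cminus_eq_0. replace (f l - w)%C with (m * (l - (l - (f l - w) / m)))%C
      by (field; exact Hm).
    rewrite El. ring.
Qed.

(** * Convexity of the image *)

(** Differentiates a local inverse of [f] along a path: the Lipschitz bound
    turns the first-order error of [f], an [o(|g s - g t|)], into an
    [o(|s - t|)]. *)
Lemma pderiv_inverse (f : C -> C) (g : R -> C) (t L : R) (F v : C) :
  F <> 0 -> 0 <= L -> cderiv f (g t) F ->
  (forall s, Cmod (g s - g t) <= L * Rabs (s - t)) ->
  pderiv (fun s => f (g s)) t v -> pderiv g t (v / F)%C.
Proof.
  intros HF HL Hf Hg Hfg eps Heps. pose proof (proj1 (Cmod_gt_0 F) HF) as PF.
  set (e := eps * Cmod F / (L + 1)).
  assert (0 < e) as He by (apply Rdiv_lt_0_compat; [apply Rmult_lt_0_compat; lra | lra]).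
  destruct (Hf e He) as [d1 [Hd1 H1]].
  destruct (Hfg e He) as [d2 [Hd2 H2]].
  exists (Rmin d2 (d1 / (L + 1))). split.
  { apply Rmin_pos; [exact Hd2 | apply Rdiv_lt_0_compat; lra]. }
  intros s Hs. pose proof (Rmin_l d2 (d1 / (L + 1))). pose proof (Rmin_r d2 (d1 / (L + 1))).
  specialize (H2 s ltac:(lra)). specialize (Hg s). pose proof (Rabs_pos (s - t)) as Ps.
  assert (Cmod (g s - g t) < d1) as Hd.
  { assert (Rabs (s - t) < d1 / (L + 1)) as H3 by lra.
    apply Rmult_lt_compat_l with (r := L + 1) in H3; [|lra].
    replace ((L + 1) * (d1 / (L + 1))) with d1 in H3 by (field; lra). lra. }
  specialize (H1 (g s) Hd).
  apply Rmult_le_reg_l with (Cmod F); [exact PF|]. rewrite <- Cmod_mult.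
  replace (F * (g s - g t - v / F * RtoC (s - t)))%C
    with ((f (g s) - f (g t) - v * RtoC (s - t)) - (f (g s) - f (g t) - F * (g s - g t)))%C
    by (field; exact HF).
  eapply Rle_trans; [apply Cmod_triangle_minus|].
  assert (e * Cmod (g s - g t) <= e * (L * Rabs (s - t))) by (apply Rmult_le_compat_l; lra).
  replace (Cmod F * (eps * Rabs (s - t))) with (e * ((L + 1) * Rabs (s - t)))
    by (unfold e; field; lra).
  lra.
Qed.

(** Extends paths on [[0, 1]] to the whole line as Lipschitz paths, so that
    two-sided continuity holds at the end points. *)
Definition clamp (t : R) : R := Rmax 0 (Rmin 1 t).

Lemma clamp_range (t : R) : 0 <= clamp t <= 1.
Proof. unfold clamp, Rmax, Rmin. destruct (Rle_dec 1 t); destruct (Rle_dec 0 _); lra. Qed.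

Lemma clamp_id (t : R) : 0 <= t <= 1 -> clamp t = t.
Proof. intros H. unfold clamp. rewrite Rmin_right, Rmax_right by lra. reflexivity. Qed.

Lemma clamp_lipschitz (s t : R) : Rabs (clamp s - clamp t) <= Rabs (s - t).
Proof.
  unfold clamp, Rmin. destruct (Rle_dec 1 s); destruct (Rle_dec 1 t); unfold Rmax;
  repeat match goal with
  | |- context [Rle_dec ?x ?y] => destruct (Rle_dec x y)
  end; unfold Rabs;
  repeat match goal with
  | |- context [Rcase_abs ?x] => destruct (Rcase_abs x)
  end; lra.
Qed.

Definition segment (p q : C) (t : R) : C := (RtoC (1 - t) * p + RtoC t * q)%C.

Lemma segment_minus (p q : C) (s t : R) :
  (segment p q s - segment p q t = (q - p) * RtoC (s - t))%C.
Proof. unfold segment. rewrite !RtoC_minus. ring. Qed.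

(** The maximum principle behind convexity.  The lift [g] of the segment
    satisfies [g' = v / f'(g)] with [v] constant, hence [g'' = - p(g) g'^2],
    and [|g p(g)| <= 1] makes [|g|^2] a convex function. *)
Lemma lifted_segment_bound (f : C -> C) (m z0 z1 : C) :
  analytic_in_disk f -> locally_univalent f ->
  (forall z, disk z -> Cmod (pre_schwarzian f z) <= 1) ->
  near_linear f m -> disk z0 -> disk z1 ->
  (forall t, 0 <= t <= 1 -> disk_image f (segment (f z0) (f z1) t)) ->
  forall (t : R) (z : C), 0 <= t <= 1 -> disk z -> f z = segment (f z0) (f z1) t ->
    Cmod z <= Rmax (Cmod z0) (Cmod z1).
Proof.
  intros Ha Hlu Hp Hnl Hz0 Hz1 Him.
  assert (forall t, exists z, disk z /\ f z = segment (f z0) (f z1) (clamp t)) as Hex.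
  { intros t. apply Him, clamp_range. }
  set (g := fun t => proj1_sig (constructive_indefinite_description _ (Hex t))).
  assert (forall t, disk (g t) /\ f (g t) = segment (f z0) (f z1) (clamp t)) as Hg.
  { intros t. unfold g. exact (proj2_sig (constructive_indefinite_description _ (Hex t))). }
  assert (forall t z, 0 <= t <= 1 -> disk z -> f z = segment (f z0) (f z1) t -> g t = z)
    as Hgz.
  { intros t z Ht Hz E. apply (near_linear_univalent f m Hnl); [apply Hg | exact Hz |].
    rewrite (proj2 (Hg t)), clamp_id by exact Ht. now rewrite E. }
  assert (g 0 = z0) as G0.
  { apply Hgz; [lra | exact Hz0 | unfold segment; rewrite Rminus_0_r; ring]. }
  assert (g 1 = z1) as G1.
  { apply Hgz; [lra | exact Hz1 | unfold segment; rewrite Rminus_diag; ring]. }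
  set (v := (f z1 - f z0)%C).
  set (L := 4 * Cmod v / Cmod m).
  pose proof (proj1 (Cmod_gt_0 m) (proj1 Hnl)) as Pm. pose proof (Cmod_ge_0 v) as Pv.
  assert (0 <= L) as PL by (apply Rdiv_le_0_compat; lra).
  assert (forall s t, Cmod (g s - g t) <= L * Rabs (s - t)) as HL.
  { intros s t. apply Rmult_le_reg_l with (Cmod m); [exact Pm|].
    eapply Rle_trans; [apply (near_linear_lower f m); [exact Hnl | apply Hg | apply Hg]|].
    rewrite (proj2 (Hg s)), (proj2 (Hg t)), segment_minus, Cmod_mult, Cmod_R.
    fold v. replace (Cmod m * (L * Rabs (s - t))) with (4 * (Cmod v * Rabs (s - t)))
      by (unfold L; field; lra).
    apply Rmult_le_compat_l; [lra|]. apply Rmult_le_compat_l; [exact Pv|].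
    apply clamp_lipschitz. }
  pose (F1 := C_derive f). pose (F2 := C_derive F1).
  pose (w := fun s => (v / F1 (g s))%C).
  assert (forall s, F1 (g s) <> 0) as HF1 by (intros s; apply Hlu, Hg).
  assert (forall t, 0 < t < 1 -> pderiv g t (w t)) as Dg.
  { intros t Ht. apply pderiv_inverse with f L; [apply HF1 | exact PL | | intros s; apply HL |].
    - now apply analytic_cderiv, Hg.
    - intros eps Heps. exists (Rmin t (1 - t)). split; [apply Rmin_pos; lra|].
      intros s Hs. pose proof (Rmin_l t (1 - t)). pose proof (Rmin_r t (1 - t)).
      assert (Rabs (s - t) < t /\ Rabs (s - t) < 1 - t) as [S1 S2] by lra.
      apply Rabs_def2 in S1. apply Rabs_def2 in S2.
      rewrite (proj2 (Hg s)), (proj2 (Hg t)), !clamp_id, segment_minus by lra. fold v.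
      replace (v * RtoC (s - t) - v * RtoC (s - t))%C with (RtoC 0) by ring.
      rewrite Cmod_0. apply Rmult_le_pos; [lra | apply Rabs_pos]. }
  pose (dw := fun s => (- (pre_schwarzian f (g s) * w s ^ 2))%C).
  assert (forall t, 0 < t < 1 -> pderiv w t (dw t)) as Dw.
  { intros t Ht.
    replace (dw t) with ((0 * F1 (g t) - v * F2 (g t)) / (F1 (g t) * F1 (g t)) * w t)%C.
    - apply (pderiv_comp (fun z => v / F1 z)%C g); [|now apply Dg].
      apply (cderiv_div (fun _ => v) F1); [apply HF1 | apply cderiv_const |].
      apply analytic_cderiv; [now apply analytic_C_derive | apply Hg].
    - unfold dw, w, pre_schwarzian. fold F1. fold F2. field. apply HF1. }
  pose (u := fun t => Re (g t) ^ 2 + Im (g t) ^ 2).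
  pose (u1 := fun t => 2 * (Re (g t) * Re (w t) + Im (g t) * Im (w t))).
  pose (u2 := fun t => 2 * (Re (w t) ^ 2 + Im (w t) ^ 2
                            + (Re (g t) * Re (dw t) + Im (g t) * Im (dw t)))).
  assert (forall t, u t = Cmod (g t) ^ 2) as Hu by (intros t; now rewrite Cmod2_alt).
  intros t z Ht Hz Ez. rewrite <- (Hgz t z Ht Hz Ez), <- G0, <- G1 at 1.
  assert (u t <= Rmax (u 0) (u 1)) as Hmax.
  { apply (convex_le_max u u1 u2 t Ht).
    - intros x _. apply continuity_pt_ext with (fun t => Cmod (g t) * Cmod (g t)).
      { intros s. rewrite Hu. ring. }
      apply continuity_pt_mult; apply Cmod_path_continuous with L;
        try exact PL; exists 1; split; try lra; intros s _; apply HL.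
    - intros x Hx.
      destruct (pderiv_Re_Im g x (w x) (Dg x Hx)) as [R1 I1].
      destruct (pderiv_Re_Im w x (dw x) (Dw x Hx)) as [R2 I2].
      split; [|split].
      + unfold u1.
        replace (2 * (Re (g x) * Re (w x) + Im (g x) * Im (w x)))
          with (INR 2 * Re (w x) * Re (g x) ^ pred 2 + INR 2 * Im (w x) * Im (g x) ^ pred 2)
          by (simpl; ring).
        apply (is_derive_plus (V := R_NormedModule)
                 (fun s => Re (g s) ^ 2) (fun s => Im (g s) ^ 2));
          apply is_derive_pow; assumption.
      + unfold u1, u2. apply is_derive_scal.
        replace (Re (w x) ^ 2 + Im (w x) ^ 2 + (Re (g x) * Re (dw x) + Im (g x) * Im (dw x)))
          with ((Re (w x) * Re (w x) + Re (g x) * Re (dw x))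
                + (Im (w x) * Im (w x) + Im (g x) * Im (dw x))) by ring.
        apply (is_derive_plus (V := R_NormedModule)
                 (fun s => Re (g s) * Re (w s)) (fun s => Im (g s) * Im (w s))).
        * apply (is_derive_mult (K := R_AbsRing) (fun s => Re (g s)) (fun s => Re (w s)));
            [assumption | assumption | exact Rmult_comm].
        * apply (is_derive_mult (K := R_AbsRing) (fun s => Im (g s)) (fun s => Im (w s)));
            [assumption | assumption | exact Rmult_comm].
      + unfold u2. rewrite <- Cmod2_alt.
        pose proof (dot_le_Cmod (g x) (- dw x)%C) as HD.
        rewrite Cmod_opp in HD. unfold dw in HD at 3. rewrite Cmod_opp, Cmod_mult, Cmod_pow in HD.
        assert (Cmod (g x) * (Cmod (pre_schwarzian f (g x)) * Cmod (w x) ^ 2)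
                <= Cmod (w x) ^ 2).
        { specialize (Hp (g x) (proj1 (Hg x))).
          pose proof (proj1 (Hg x)) as Hd. unfold disk in Hd.
          pose proof (Cmod_ge_0 (g x)). pose proof (Cmod_ge_0 (pre_schwarzian f (g x))).
          pose proof (pow2_ge_0 (Cmod (w x))).
          assert (Cmod (g x) * Cmod (pre_schwarzian f (g x)) <= 1) by nra. nra. }
        replace (Re (- dw x)%C) with (- Re (dw x)) in HD by reflexivity.
        replace (Im (- dw x)%C) with (- Im (dw x)) in HD by reflexivity.
        lra. }
  rewrite !Hu in Hmax. apply Rnot_lt_le. intros Hlt.
  pose proof (Rmax_l (Cmod (g 0)) (Cmod (g 1))).
  pose proof (Rmax_r (Cmod (g 0)) (Cmod (g 1))).
  pose proof (Cmod_ge_0 (g 0)). pose proof (Cmod_ge_0 (g 1)).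
  assert (Rmax (Cmod (g 0) ^ 2) (Cmod (g 1) ^ 2) < Cmod (g t) ^ 2); [|lra].
  apply Rmax_lub_lt; apply pow_lt_compat_l || nra.
Qed.

(** Continuation in the end point, which runs from [z0] to [z1] in finitely many
    equal steps.  By the maximum principle each lifted segment stays in
    [|z| <= r], where [near_linear_open] holds with one radius [e], and the steps
    are short enough to move the image by at most [e]. *)
Lemma near_linear_convex (f : C -> C) (m : C) :
  analytic_in_disk f -> locally_univalent f ->
  (forall z, disk z -> Cmod (pre_schwarzian f z) <= 1) ->
  near_linear f m -> convex_set (disk_image f).
Proof.
  intros Ha Hlu Hp Hnl p q t [z0 [Hz0 <-]] [z1 [Hz1 <-]] Ht.
  set (r := Rmax (Cmod z0) (Cmod z1)).
  assert (r < 1) as Hr by now apply Rmax_lub_lt.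
  pose proof (proj1 (Cmod_gt_0 m) (proj1 Hnl)) as Pm.
  set (e := Cmod m * (1 - r) / 8).
  assert (0 < e) as He by (unfold e; apply Rdiv_lt_0_compat; [apply Rmult_lt_0_compat|]; lra).
  pose (c := fun s => (z0 + RtoC s * (z1 - z0))%C).
  assert (forall s, 0 <= s <= 1 -> disk (c s) /\ Cmod (c s) <= r) as Hc.
  { intros s Hs. split; [now apply disk_segment|].
    replace (c s) with (RtoC (1 - s) * z0 + RtoC s * z1)%C
      by (unfold c; rewrite RtoC_minus; ring).
    eapply Rle_trans; [apply Cmod_triangle|].
    rewrite !Cmod_mult, !Cmod_R, !Rabs_pos_eq by lra.
    pose proof (Rmult_le_compat_l (1 - s) _ _ ltac:(lra) (Rmax_l (Cmod z0) (Cmod z1))).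
    pose proof (Rmult_le_compat_l s _ _ ltac:(lra) (Rmax_r (Cmod z0) (Cmod z1))).
    unfold r. lra. }
  set (B := 2 * Cmod m * Cmod (z1 - z0)).
  assert (0 <= B) as PB.
  { unfold B. pose proof (Cmod_ge_0 (z1 - z0)). apply Rmult_le_pos; lra. }
  destruct (nfloor_ex (B / e)) as [N [_ HN]]; [now apply Rdiv_le_0_compat|].
  assert (B <= e * INR (S N)) as HBN.
  { rewrite S_INR. apply Rmult_lt_compat_l with (r := e) in HN; [|exact He].
    replace (e * (B / e)) with B in HN by (field; lra). lra. }
  assert (0 < INR (S N)) as PN by apply lt_0_INR, Nat.lt_0_succ.
  assert (forall n, (n <= S N)%nat -> forall t, 0 <= t <= 1 ->
    disk_image f (segment (f z0) (f (c (INR n / INR (S N)))) t)) as Hind.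
  { induction n as [|n IH]; intros Hn s Hs.
    - exists z0. split; [exact Hz0|]. unfold c, Rdiv. simpl (INR 0). rewrite Rmult_0_l.
      replace (z0 + 0 * (z1 - z0))%C with z0 by ring.
      unfold segment. rewrite RtoC_minus. ring.
    - assert (n <= S N)%nat as Hn' by lia. specialize (IH Hn').
      set (a := INR n / INR (S N)) in *. set (b := INR (S n) / INR (S N)).
      assert (forall k, (k <= S N)%nat -> 0 <= INR k / INR (S N) <= 1) as Hfrac.
      { intros k Hk. split; [apply Rdiv_le_0_compat; [apply pos_INR | exact PN]|].
        apply Rmult_le_reg_r with (INR (S N)); [exact PN|].
        unfold Rdiv. rewrite Rmult_assoc, Rinv_l, Rmult_1_r, Rmult_1_l by lra.
        now apply le_INR. }
      destruct (Hc a (Hfrac n Hn')) as [Da Ca]. destruct (Hc b (Hfrac (S n) Hn)) as [Db Cb].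
      destruct (IH s Hs) as [z [Dz Ez]].
      assert (Cmod z <= r) as Hzr.
      { eapply Rle_trans.
        - now apply (lifted_segment_bound f m z0 (c a) Ha Hlu Hp Hnl Hz0 Da IH s).
        - apply Rmax_lub; [apply Rmax_l | exact Ca]. }
      apply (near_linear_open f m z _ r Hnl Hr Hzr). fold e. rewrite Ez.
      replace (segment (f z0) (f (c b)) s - segment (f z0) (f (c a)) s)%C
        with (RtoC s * (f (c b) - f (c a)))%C by (unfold segment; ring).
      rewrite Cmod_mult, Cmod_R, Rabs_pos_eq by lra.
      assert (Cmod (f (c b) - f (c a)) <= e) as Hstep.
      { eapply Rle_trans; [apply (near_linear_upper f m); assumption|].
        replace (c b - c a)%C with (RtoC (/ INR (S N)) * (z1 - z0))%C.
        - rewrite Cmod_mult, Cmod_R, Rabs_pos_eq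
            by (apply Rlt_le, Rinv_0_lt_compat, PN).
          replace (2 * Cmod m * (/ INR (S N) * Cmod (z1 - z0))) with (B / INR (S N))
            by (unfold B; field; lra).
          apply Rmult_le_reg_r with (INR (S N)); [exact PN|].
          unfold Rdiv. rewrite Rmult_assoc, Rinv_l, Rmult_1_r by lra. exact HBN.
        - replace (/ INR (S N)) with (b - a).
          + unfold c. rewrite RtoC_minus. ring.
          + unfold a, b. rewrite (S_INR n). field. lra. }
      pose proof (Cmod_ge_0 (f (c b) - f (c a))). nra. }
  specialize (Hind (S N) (le_n _) t Ht).
  unfold Rdiv in Hind. rewrite Rinv_r in Hind by lra.
  replace (c 1) with z1 in Hind by (unfold c; ring). exact Hind.
Qed.

(** * Bounds on the pre-Schwarzian derivative and its consequences *)

(** Comparison of Riccati equations: [p' = Sf + p^2/2] along a radius and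
    [y' - y^2/2] bounding [|Sf|] give
    [|p'| <= y' + (|p| - y) (|p| + y) / 2]. *)
Lemma pre_schwarzian_le_majorant (f : C -> C) (y dy : R -> R) :
  analytic_in_disk f -> locally_univalent f -> C_derive (C_derive f) 0 = 0 ->
  (forall x, 0 <= x < 1 -> is_derive y x (dy x) /\ 0 <= y x) ->
  (forall z, disk z ->
    Cmod (schwarzian f z) <= dy (Cmod z) - / 2 * y (Cmod z) ^ 2) ->
  forall z, disk z -> Cmod (pre_schwarzian f z) <= y (Cmod z).
Proof.
  intros Ha Hlu H0 Hy HS z Hz. unfold disk in Hz. pose proof (Cmod_ge_0 z) as Pz.
  set (p := pre_schwarzian f).
  assert (Cmod (p 0) <= y 0) as Hp0.
  { unfold p, pre_schwarzian. rewrite H0. unfold Cdiv. rewrite Cmult_0_l, Cmod_0.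
    apply Hy. lra. }
  assert (forall w, disk w -> cderiv p w (C_derive p w)) as Dp.
  { intros w Hw.
    pose proof (cderiv_div (C_derive (C_derive f)) (C_derive f) w _ _ (Hlu w Hw)
      (analytic_cderiv _ w (analytic_C_derive _ (analytic_C_derive _ Ha)) Hw)
      (analytic_cderiv _ w (analytic_C_derive _ Ha) Hw)) as H.
    change (fun x => (C_derive (C_derive f) x / C_derive f x)%C) with p in H.
    now rewrite (cderiv_C_derive _ _ _ H). }
  destruct (Req_dec (Cmod z) 0) as [Ez|Nz].
  { rewrite Ez. apply Cmod_eq_0 in Ez. now rewrite Ez. }
  pose (u := (z / RtoC (Cmod z))%C).
  assert (RtoC (Cmod z) <> 0) as Nz' by (intros E; apply Nz; now injection E).
  assert (Cmod u = 1) as Hu.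
  { unfold u. rewrite Cmod_div by exact Nz'. rewrite Cmod_R, Rabs_pos_eq by lra.
    field. exact Nz. }
  pose (g := fun s : R => (0 + RtoC s * u)%C).
  assert (forall s, 0 <= s -> Cmod (g s) = s) as Hg.
  { intros s Hs. unfold g. rewrite Cplus_0_l, Cmod_mult, Hu, Cmod_R, Rabs_pos_eq; lra. }
  assert (g (Cmod z) = z) as Gz by (unfold g, u; field; exact Nz').
  assert (g 0 = 0) as G0 by (unfold g; ring).
  assert (forall s, 0 <= s <= Cmod z -> pderiv (fun s => p (g s)) s (C_derive p (g s) * u)%C)
    as Dq.
  { intros s Hs. apply pderiv_comp; [|apply pderiv_line].
    apply Dp. unfold disk. rewrite Hg; lra. }
  assert (forall s, 0 <= s <= Cmod z -> is_derive y s (dy s)) as Dy by (intros s Hs; apply Hy; lra).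
  (* a bound on |p| + y, needed for a constant rate K in the comparison *)
  destruct (continuity_ab_maj (fun s => Cmod (p (g s)) + y s) 0 (Cmod z) Pz) as [M [HM _]].
  { intros s Hs. apply continuity_pt_plus.
    - apply Cmod_path_continuous with (Cmod (C_derive p (g s) * u) + 1).
      + pose proof (Cmod_ge_0 (C_derive p (g s) * u)). lra.
      + now apply pderiv_bound, Dq.
    - apply derivable_continuous_pt. exists (dy s). apply is_derive_Reals. now apply Dy. }
  set (K := Cmod (p (g M)) + y M) in HM.
  rewrite <- Gz at 1.
  apply (comparison (fun s => p (g s)) (fun s => C_derive p (g s) * u)%C y dy (K / 2)).
  - exact Pz.
  - exact Dq.
  - exact Dy.
  - intros s Hs. apply Hy. lra.
  - now rewrite G0.
  - intros s Hs Hlt. rewrite Cmod_mult, Hu, Rmult_1_r.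
    assert (disk (g s)) as Hgs by (unfold disk; rewrite Hg; lra).
    specialize (HS (g s) Hgs). rewrite Hg in HS by lra.
    replace (C_derive p (g s)) with (schwarzian f (g s) + / RtoC 2 * p (g s) ^ 2)%C
      by (unfold schwarzian; fold p; ring).
    eapply Rle_trans; [apply Cmod_triangle|].
    rewrite Cmod_mult, Cmod_inv, Cmod_R, Rabs_pos_eq, Cmod_pow
      by (lra || (intros E; injection E; lra)).
    specialize (HM s Hs). nra.
Qed.

Lemma exp_half_le : exp (1 / 2) <= 7 / 4.
Proof.
  pose proof exp_le_3 as H. pose proof (exp_pos (1 / 2)).
  replace 1 with (1 / 2 + 1 / 2) in H at 1 by lra. rewrite exp_plus in H. nra.
Qed.

(** From [f'' = p f'] and [|p(s z)| <= s], the quantity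
    [|f'(s z) - f'(0)|] is a subsolution of [Y' = s (Y + |f'(0)|)], which
    [|f'(0)| (exp (s^2/2) - 1)] solves. *)
Lemma derivative_oscillation (f : C -> C) :
  analytic_in_disk f -> locally_univalent f ->
  (forall z, disk z -> Cmod (pre_schwarzian f z) <= Cmod z) ->
  forall z, disk z ->
    Cmod (C_derive f z - C_derive f 0) <= 3 / 4 * Cmod (C_derive f 0).
Proof.
  intros Ha Hlu Hp z Hz. unfold disk in Hz. pose proof (Cmod_ge_0 z) as Pz.
  set (F := C_derive f). set (A := Cmod (F 0)).
  assert (0 <= A) as PA by apply Cmod_ge_0.
  pose (g := fun s : R => (0 + RtoC s * z)%C).
  assert (forall s, 0 <= s -> Cmod (g s) = s * Cmod z) as Hg.
  { intros s Hs. unfold g. rewrite Cplus_0_l, Cmod_mult, Cmod_R, Rabs_pos_eq; lra. }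
  assert (forall s, 0 <= s <= 1 -> disk (g s)) as Hgd.
  { intros s Hs. unfold disk. rewrite Hg by lra. nra. }
  assert (g 1 = z) as G1 by (unfold g; ring).
  assert (g 0 = 0) as G0 by (unfold g; ring).
  apply Rle_trans with (A * (exp (1 ^ 2 / 2) - 1)).
  2:{ replace (1 ^ 2 / 2) with (1 / 2) by lra. pose proof exp_half_le. nra. }
  rewrite <- G1 at 1.
  apply (comparison (fun s => F (g s) - F 0)%C (fun s => C_derive F (g s) * z)%C
           (fun s => A * (exp (s ^ 2 / 2) - 1)) (fun s => A * (s * exp (s ^ 2 / 2))) 1 1).
  - lra.
  - intros s Hs. apply pderiv_minus_const, pderiv_comp; [|apply pderiv_line].
    apply analytic_cderiv; [now apply analytic_C_derive | now apply Hgd].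
  - intros s _. auto_derive; [exact I|].
    change (s * (s * 1) * / 2) with (s ^ 2 / 2). field.
  - intros s Hs. apply Rmult_le_pos; [exact PA|].
    pose proof (exp_ineq1_le (s ^ 2 / 2)). pose proof (pow2_ge_0 s). lra.
  - rewrite G0. replace (F 0 - F 0)%C with (RtoC 0) by ring. rewrite Cmod_0.
    replace (0 ^ 2 / 2) with 0 by lra. rewrite exp_0. lra.
  - intros s Hs Hlt. specialize (Hp (g s) (Hgd s Hs)).
    replace (C_derive F (g s)) with (pre_schwarzian f (g s) * F (g s))%C
      by (unfold pre_schwarzian; fold F; field; apply Hlu, Hgd, Hs).
    rewrite !Cmod_mult. rewrite Hg in Hp by lra.
    assert (Cmod (F (g s)) <= Cmod (F (g s) - F 0) + A) as HF.
    { replace (F (g s)) with ((F (g s) - F 0) + F 0)%C at 1 by ring. apply Cmod_triangle. }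
    set (Q := Cmod (F (g s) - F 0)) in *.
    pose proof (Cmod_ge_0 (F (g s))). pose proof (Cmod_ge_0 (pre_schwarzian f (g s))).
    assert (Cmod (pre_schwarzian f (g s)) * Cmod (F (g s)) * Cmod z <= s * (Q + A)).
    { apply Rle_trans with (s * (Q + A) * 1); [|lra].
      apply Rmult_le_compat; try lra; [now apply Rmult_le_pos|].
      apply Rmult_le_compat; try lra. nra. }
    set (X := exp (s ^ 2 / 2)) in *. nra.
Qed.

Lemma convex_mapping_of_pre_schwarzian (f : C -> C) :
  analytic_in_disk f -> locally_univalent f ->
  (forall z, disk z -> Cmod (pre_schwarzian f z) <= Cmod z) -> convex_mapping f.
Proof.
  intros Ha Hlu Hp. set (m := C_derive f 0).
  assert (near_linear f m) as Hnl.
  { split.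
    - apply Hlu. unfold disk. rewrite Cmod_0. lra.
    - intros z w Hz Hw.
      replace (f z - f w - m * (z - w))%C
        with ((- m * z + 1 * f z) - (- m * w + 1 * f w))%C by ring.
      apply (lipschitz_disk (fun z => - m * z + 1 * f z)%C
               (fun z => - m + 1 * C_derive f z)%C); [|exact Hz | exact Hw].
      intros x Hx. split.
      + apply cderiv_affine. now apply analytic_cderiv.
      + replace (- m + 1 * C_derive f x)%C with (C_derive f x - m)%C by ring.
        now apply derivative_oscillation. }
  split; [exact Ha|]. split; [now apply near_linear_univalent with m|].
  apply near_linear_convex with m; auto.
  intros z Hz. specialize (Hp z Hz). unfold disk in Hz. lra.
Qed.

(** * The critical value and its majorant *)

Lemma taylor_bounds (x : R) : 0 <= x <= 1 ->
  x - x ^ 3 / 6 <= sin x <= x - x ^ 3 / 6 + x ^ 5 / 120 /\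
  1 - x ^ 2 / 2 + x ^ 4 / 24 - x ^ 6 / 720 <= cos x <= 1 - x ^ 2 / 2 + x ^ 4 / 24.
Proof.
  intros Hx. pose proof PI2_1 as P.
  destruct (sin_bound x 0) as [S1 S2]; [lra | lra |].
  destruct (cos_bound x 0) as [_ C2]; [lra | lra |].
  destruct (cos_bound x 1) as [C1 _]; [lra | lra |].
  unfold sin_approx, cos_approx, sin_term, cos_term in *.
  cbn [Nat.mul Nat.add sum_f_R0] in *. rewrite !INR_IZR_INZ in *.
  cbn [Factorial.fact Nat.mul Nat.add Z.of_nat Pos.of_succ_nat Pos.succ] in *.
  repeat split; lra.
Qed.

(** [2 x tan x - 1] multiplied by [cos x], to avoid the poles. *)
Definition critical_gap (x : R) : R := 2 * x * sin x - cos x.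

Lemma cos_pos_le_1 (x : R) : 0 <= x <= 1 -> 0 < cos x.
Proof. intros Hx. pose proof PI2_1. apply cos_gt_0; lra. Qed.

Lemma is_solution_gap (x : R) : is_solution x -> critical_gap x = 0.
Proof.
  intros [Hc H]. unfold critical_gap, tan in *.
  replace (2 * x * sin x) with (2 * x * (sin x / cos x) * cos x) by (field; exact Hc).
  rewrite H. ring.
Qed.

Lemma gap_is_solution (x : R) : cos x <> 0 -> critical_gap x = 0 -> is_solution x.
Proof.
  intros Hc H. split; [exact Hc|]. unfold critical_gap, tan in *.
  replace (2 * x * (sin x / cos x)) with ((2 * x * sin x) / cos x) by (field; exact Hc).
  replace (2 * x * sin x) with (cos x) by lra. now field.
Qed.

Lemma gap_increasing (x y : R) : 0 < x -> x < y -> y <= 1 -> critical_gap x < critical_gap y.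
Proof.
  intros Hx Hxy Hy. unfold critical_gap. pose proof PI2_1 as P. pose proof PI_RGT_0.
  assert (sin x < sin y) by (apply sin_increasing_1; lra).
  assert (cos y < cos x) by (apply cos_decreasing_1; lra).
  assert (0 < sin x) by (apply sin_gt_0; lra). nra.
Qed.

Lemma gap_signs : critical_gap 0.653 < 0 /\ 0 < critical_gap 0.654.
Proof.
  unfold critical_gap.
  destruct (taylor_bounds 0.653) as [[_ S] [C _]]; [lra|].
  destruct (taylor_bounds 0.654) as [[S' _] [_ C']]; [lra|].
  split; lra.
Qed.

Lemma first_solution_exists : exists a : R, first_positive_solution a /\ 0.653 <= a < 0.654.
Proof.
  destruct gap_signs as [G1 G2].
  assert (continuity critical_gap) as Hc by (unfold critical_gap; reg).
  destruct (IVT critical_gap 0.653 0.654 Hc) as [a [Ha E]]; [lra | lra | lra |].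
  exists a. repeat split; try lra.
  - apply Rgt_not_eq, cos_pos_le_1. lra.
  - apply gap_is_solution; [apply Rgt_not_eq, cos_pos_le_1; lra | exact E].
  - intros b Hb Sb. apply Rnot_lt_le. intros Hlt.
    pose proof (gap_increasing b a Hb Hlt ltac:(lra)) as H.
    rewrite E, (is_solution_gap b Sb) in H. lra.
  - destruct Ha as [_ [Hlt|Heq]]; [exact Hlt|]. rewrite Heq in E. lra.
Qed.

Lemma is_derive_tan_scaled (a x : R) :
  cos (a * x) <> 0 -> is_derive (fun x => tan (a * x)) x (a * (1 + tan (a * x) ^ 2)).
Proof.
  intros Hc. unfold tan. auto_derive; [exact Hc|].
  pose proof (sin2_cos2 (a * x)) as E. unfold Rsqr in E.
  field_simplify; [|exact Hc | exact Hc].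
  reflexivity.
Qed.

(** Convexity of [tan] on [[0, PI/2)], with [tan 0 = 0]. *)
Lemma tan_chord (a x : R) :
  0 < a <= 1 -> 0 <= x <= 1 -> tan (a * x) <= x * tan a.
Proof.
  intros Ha Hx.
  assert (forall s, 0 <= s <= 1 -> 0 < cos (a * s)) as Hcos.
  { intros s Hs. apply cos_pos_le_1. nra. }
  pose (u := fun s => tan (a * s) - s * tan a).
  assert (u x <= Rmax (u 0) (u 1)) as H.
  { apply (convex_le_max u (fun s => a * (1 + tan (a * s) ^ 2) - tan a)
      (fun s => a * (2 * tan (a * s) * (a * (1 + tan (a * s) ^ 2)))) x Hx).
    - intros s Hs. apply derivable_continuous_pt.
      exists (a * (1 + tan (a * s) ^ 2) - tan a). apply is_derive_Reals.
      apply (is_derive_minus (V := R_NormedModule) (fun s => tan (a * s)) (fun s => s * tan a)).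
      + apply is_derive_tan_scaled. apply Rgt_not_eq, Hcos, Hs.
      + auto_derive; [exact I | ring].
    - intros s Hs.
      assert (is_derive (fun x => tan (a * x)) s (a * (1 + tan (a * s) ^ 2))) as D.
      { apply is_derive_tan_scaled. apply Rgt_not_eq, Hcos. lra. }
      split; [|split].
      + apply (is_derive_minus (V := R_NormedModule) (fun s => tan (a * s)) (fun s => s * tan a));
          [exact D | auto_derive; [exact I | ring]].
      + evar_last.
        * apply (is_derive_minus (V := R_NormedModule)
                   (fun s => a * (1 + tan (a * s) ^ 2)) (fun s => tan a));
            [|apply is_derive_const].
          apply is_derive_scal.
          apply (is_derive_plus (V := R_NormedModule) (fun s => 1) (fun s => tan (a * s) ^ 2));
            [apply is_derive_const | apply is_derive_pow; exact D].
        * unfold minus, plus, opp, zero. simpl. ring.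
      + assert (0 <= tan (a * s)).
        { unfold tan. apply Rdiv_le_0_compat; [|apply Hcos; lra].
          pose proof PI2_1. assert (0 <= a * s <= 1) by nra. apply sin_ge_0; lra. }
        pose proof (pow2_ge_0 (tan (a * s))).
        apply Rmult_le_pos; [lra|]. apply Rmult_le_pos; [lra|]. apply Rmult_le_pos; lra. }
  unfold u in H. rewrite Rmult_0_r, Rmult_1_r, tan_0 in H.
  replace (0 - 0 * tan a) with 0 in H by ring.
  replace (tan a - 1 * tan a) with 0 in H by ring.
  rewrite Rmax_left in H by lra. lra.
Qed.

Theorem theorem5p2 :
  exists a : R,
    first_positive_solution a /\ 0.653 <= a < 0.654 /\
    forall f : C -> C,
      analytic_in_disk f ->
      locally_univalent f ->
      C_derive (C_derive f) (RtoC 0) = RtoC 0 ->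
      ((forall z : C, disk z -> Cmod (schwarzian f z) <= 2 * a ^ 2) ->
        convex_mapping f) /\
      ((exists n : nat, (1 <= n)%nat /\
          forall z : C, disk z ->
            Cmod (schwarzian f z)
              <= INR n * Cmod z ^ (n - 1) - / 2 * Cmod z ^ (2 * n)) ->
        convex_mapping f).
Proof.
  destruct first_solution_exists as [a [Hsol Hrange]].
  exists a. split; [exact Hsol|]. split; [exact Hrange|].
  destruct Hsol as [Hpos [[_ Heq] _]].
  intros f Ha Hlu H0. split.
  (* 2 a tan (a x) <= 2 a x tan a = x *)
  - intros HS. apply convex_mapping_of_pre_schwarzian; [exact Ha | exact Hlu |].
    intros z Hz.
    apply Rle_trans with (2 * a * tan (a * Cmod z)).
    + apply (pre_schwarzian_le_majorant f (fun x => 2 * a * tan (a * x))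
               (fun x => 2 * a * (a * (1 + tan (a * x) ^ 2)))); try assumption.
      * intros x Hx.
        assert (0 < cos (a * x)) as Hc by (apply cos_pos_le_1; nra).
        split.
        -- apply is_derive_scal, is_derive_tan_scaled. lra.
        -- apply Rmult_le_pos; [lra|]. unfold tan. apply Rdiv_le_0_compat; [|exact Hc].
           pose proof PI2_1. assert (0 <= a * x <= 1) by nra. apply sin_ge_0; lra.
      * intros w Hw. eapply Rle_trans; [now apply HS|]. right. field.
    + pose proof (Cmod_ge_0 z). unfold disk in Hz.
      pose proof (tan_chord a (Cmod z) ltac:(lra) ltac:(lra)). nra.
  - intros [n [Hn HS]]. apply convex_mapping_of_pre_schwarzian; [exact Ha | exact Hlu |].
    intros z Hz.
    apply Rle_trans with (Cmod z ^ n).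
    + apply (pre_schwarzian_le_majorant f (fun x => x ^ n) (fun x => INR n * x ^ (n - 1)));
        try assumption.
      * intros x Hx. split; [|apply pow_le; lra].
        rewrite Nat.sub_1_r. auto_derive; [exact I | ring].
      * intros w Hw. rewrite <- pow_mult, Nat.mul_comm. now apply HS.
    + pose proof (Cmod_ge_0 z). unfold disk in Hz. destruct n as [|n]; [lia|].
      assert (Cmod z ^ n <= 1) as H1 by (rewrite <- (pow1 n); apply pow_incr; lra).
      simpl. nra.
Qed.
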